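(* Let $T$ be an unbounded densely defined closed operator on a Hilbert space $H$, let $\gamma:[0,1]\to\mathcal{R}$ be the unique minimal geodesic in the Riemann sphere $\mathcal{R}$ of $B(H)$ with $\gamma(0)=P_{\mathrm{Gr}(0)}$ and $\gamma(1)=P_{\mathrm{Gr}(T)}$, and write $\dot\gamma(0)=\begin{pmatrix} 0 & a \\ a^* & 0 \end{pmatrix}$ with $a\in B(H)$. For $t\in[0,1)$ let $$T_t=A(t)=ta^*(\operatorname{sinc}|ta^*|)(\cos|ta^*|)^{-1}=v\tan|ta^*|\in B(H),$$ where $a^*=v|a^*|$ is the polar decomposition, so that $\gamma(t)=P_{\mathrm{Gr}(A(t))}$. Then $\{T_t\}_{t\in[0,1)}$ is an optimal bounded deformation of $T$; that is, with $\tilde p_t=P_{\mathrm{Gr}(T_t)}$ and $\tilde p_1=P_{\mathrm{Gr}(T)}$, $$\operatorname{length}\big(\tilde p_t|_{t\in[t_0,1]}\big)=\operatorname{dist}(\tilde p_{t_0},\tilde p_1)\qquad\text{for every }t_0\in[0,1).$$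
   Context: $\mathrm{Gr}(S)=\{(h,Sh):h\in\operatorname{Dom}(S)\}\subset H\times H$, and $P_{\mathrm{Gr}(S)}$ is the orthogonal projection onto it. The Riemann sphere of $B(H)$ is $\mathcal{R}=\{\tilde u\tilde p_0\tilde u^*:\tilde u\text{ unitary in }B(H\oplus H)\}$, $\tilde p_0=P_{\mathrm{Gr}(0)}=\begin{pmatrix} 1 & 0 \\ 0 & 0 \end{pmatrix}$. Its tangent space at $\tilde p$ is $\{X\in B(H\oplus H):X^*=X,\ X\tilde p+\tilde pX=X\}$ with Finsler norm the operator norm; $\operatorname{length}$ of a curve is $\int\|\dot\gamma\|\,dt$ and $\operatorname{dist}$ is the infimum of lengths of curves in $\mathcal{R}$ with given endpoints. Geodesics are the curves $\gamma(t)=e^{t\tilde X}\tilde pe^{-t\tilde X}$, $X$ tangent at $\tilde p$, $\tilde X=X\tilde p-\tilde pX$; minimal means length equal to the distance between the endpoints. $|b|=(b^*b)^{1/2}$, $\operatorname{sinc}(x)=\sin(x)/x$. A bounded deformation of an unbounded closed operator $T$ is a family $\{T_t\}_{t\in[0,\alpha)}$, $\alpha>0$, of bounded operators such that $t\mapsto T_t$ is norm continuous and $\lim_{t\to\alpha^-}P_{\mathrm{Gr}(T_t)}=P_{\mathrm{Gr}(T)}$ in the Finsler metric of $\mathcal{R}$. It is optimal if, with $\tilde p_t=P_{\mathrm{Gr}(T_t)}$ and $\tilde p_\alpha=P_{\mathrm{Gr}(T)}$, $\operatorname{dist}(\tilde p_{t_0},\tilde p_\alpha)$ equals the length of $\tilde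 p_t$, $t\in[t_0,\alpha]$, for every $t_0\in[0,\alpha)$. *)

(* Defs.v *)
From HB Require Import structures.
From mathcomp Require Import all_boot all_order all_algebra complex.
From mathcomp Require Import all_classical all_reals all_analysis.
From mathcomp Require Import ring lra.

Set Implicit Arguments.
Unset Strict Implicit.
Unset Printing Implicit Defensive.

Import Order.TTheory GRing.Theory Num.Theory.
Import numFieldNormedType.Exports.

Local Open Scope classical_set_scope.
Local Open Scope ring_scope.

(* Inner products are linear in the first and antilinear in the second
   variable. *)
Notation inner V := {dot V for @Num.conj _}.

HB.mixin Record isHilbert (R : realType) H
    of CompleteNormedModule R[i] H := {
  hdot : inner H;
  hdot_norm : forall x : H, `|x| ^+ 2 = hdot x x
}.

#[short(type="hilbertType")]
HB.structure Definition Hilbert (R : realType) :=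
  {H of CompleteNormedModule R[i] H & isHilbert R H}.

Section InnerNorm.
Variables (R : realType) (V : lmodType R[i]) (dot : inner V).
Implicit Types x y : V.

Definition inorm x : R := Num.sqrt (complex.Re (dot x x)).

Let sq x : R := complex.Re (dot x x).

Lemma dot_ge0 x : 0 <= dot x x.
Proof.
have [->|x0] := eqVneq x 0; first by rewrite linear0l.
exact/ltW/neq0_dnorm_gt0.
Qed.

Let sq_ge0 x : 0 <= sq x.
Proof. by have := dot_ge0 x; rewrite lecE => /andP[]. Qed.

Let sqC x : (sq x)%:C%C = dot x x.
Proof. by rewrite /sq RRe_real // ger0_real // dot_ge0. Qed.

Lemma inorm2 x : inorm x ^+ 2 = complex.Re (dot x x).
Proof. by rewrite sqr_sqrtr // sq_ge0. Qed.

Let ReD : {morph (@complex.Re R) : z w / z + w}.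
Proof. by move=> [? ?] [? ?]. Qed.

Let ReZ (r : R) z : complex.Re (r%:C%C * z) = r * complex.Re z.
Proof. by case: z => a b /=; ring. Qed.

Let ReC x y : complex.Re (dot y x) = complex.Re (dot x y).
Proof.
by rewrite hermC expr0 mul1r; apply: (@complexI R); rewrite !complexRe Re_conj.
Qed.

Lemma inorm_ge0 x : 0 <= inorm x.
Proof. exact: sqrtr_ge0. Qed.

Lemma inorm0 : inorm 0 = 0.
Proof. by rewrite /inorm linear0l /= sqrtr0. Qed.

Lemma inorm_eq0 x : inorm x = 0 -> x = 0.
Proof.
move=> x0; have [//|/(@neq0_dnorm_gt0 _ _ _ dot)] := eqVneq x 0.
by rewrite -sqC /sq -inorm2 x0 expr0n ltxx.
Qed.

Lemma inormZ (a : R[i]) x : inorm (a *: x) = complex.Re `|a| * inorm x.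
Proof.
apply/eqP; rewrite -(@eqrXn2 _ 2) ?inorm_ge0 ?mulr_ge0 ?inorm_ge0 //; last first.
  by case: a => a b; rewrite normc_def /= sqrtr_ge0.
rewrite exprMn !inorm2 linearZl_LR linearZr_LR /= mulrA -normCK.
have -> : `|a| ^+ 2 = ((complex.Re `|a|) ^+ 2)%:C%C.
  by rewrite rmorphXn; congr (_ ^+ 2); rewrite [RHS]RRe_real ?normr_real.
by rewrite ReZ.
Qed.

Let sqD x y (r : R) :
  sq (x + r%:C%C *: y) = sq x + 2 * r * complex.Re (dot x y) + r ^+ 2 * sq y.
Proof.
have rC : (r%:C%C)^* = r%:C%C :> R[i].
  by apply/CrealP; rewrite complex_real.
have -> : sq (x + r%:C%C *: y) = complex.Re (dot x x + r%:C%C * dot x y +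
    (r%:C%C * dot y x + r%:C%C * (r%:C%C * dot y y))).
  by rewrite /sq linearDl !linearDr !linearZl_LR !linearZr_LR /= rC.
by rewrite !ReD !ReZ (ReC x y) /sq; ring.
Qed.

Lemma inorm_CauchySchwarz x y : complex.Re (dot x y) <= inorm x * inorm y.
Proof.
have [->|y0] := eqVneq y 0; first by rewrite linear0r inorm0 mulr0.
have sy : 0 < sq y.
  rewrite lt_neqAle sq_ge0 andbT; apply: contra_neq y0 => y0.
  by apply: inorm_eq0; rewrite /inorm -/(sq y) -y0 sqrtr0.
have [r0|r0] := leP (complex.Re (dot x y)) 0.
  by rewrite (le_trans r0) // mulr_ge0 ?inorm_ge0.
rewrite -(@ler_pXn2r _ 2) ?nnegrE ?mulr_ge0 ?inorm_ge0 ?(ltW r0) //.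
rewrite exprMn !inorm2 -!/(sq _).
have := sq_ge0 (x + (- complex.Re (dot x y) / sq y)%:C%C *: y).
rewrite sqD; set r := complex.Re _ in r0 *.
rewrite -(pmulr_lge0 _ sy).
have -> : (sq x + 2 * (- r / sq y) * r + (- r / sq y) ^+ 2 * sq y) * sq y =
  sq x * sq y - r ^+ 2 by field; rewrite gt_eqF.
by rewrite subr_ge0.
Qed.

Lemma inormD x y : inorm (x + y) <= inorm x + inorm y.
Proof.
rewrite -(@ler_pXn2r _ 2) ?nnegrE ?addr_ge0 ?inorm_ge0 //.
have := sqD x y 1; rewrite rmorph1 scale1r inorm2 -/(sq _) => ->.
have := inorm_CauchySchwarz x y; rewrite sqrrD !inorm2 /sq; lra.
Qed.

End InnerNorm.

Section BoundedOperators.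
Variables (R : realType) (V : lmodType R[i]) (dot : inner V).


Definition bounded_linear (f : V -> V) : Prop :=
  linear f /\ exists C : R, forall x, inorm dot (f x) <= C * inorm dot x.

Record bop := Bop {
  bop_fun :> V -> V;
  bop_subproof : `[< bounded_linear bop_fun >]
}.

HB.instance Definition _ := [isSub for bop_fun].
HB.instance Definition _ := [Choice of bop by <:].

Implicit Types f g h : bop.

Lemma bopP f g : (forall x, f x = g x) -> f = g.
Proof. by move=> fg; apply/val_inj/funext. Qed.

Lemma bop_linear f : linear f.
Proof. by case: f => f /= /asboolP[]. Qed.

HB.instance Definition _ f :=
  GRing.isLinear.Build R[i] V V _ (bop_fun f) (bop_linear f).

Lemma bop_bounded f : exists2 C : R, 0 <= C &
  forall x, inorm dot (f x) <= C * inorm dot x.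
Proof.
case: f => f /= /asboolP[_ [C fC]]; exists `|C| => // x.
by rewrite (le_trans (fC x)) // ler_wpM2r ?inorm_ge0 // ler_norm.
Qed.


Lemma bounded_linear0 : bounded_linear (fun=> 0).
Proof.
by split=> [a x y|]; [rewrite scaler0 addr0|exists 0 => x; rewrite inorm0 mul0r].
Qed.

Lemma bounded_linearD f g : bounded_linear (fun x => f x + g x).
Proof.
split=> [a x y|]; first by rewrite !linearP scalerDr addrACA.
have [C _ fC] := bop_bounded f; have [D _ gD] := bop_bounded g.
by exists (C + D) => x; rewrite (le_trans (inormD _ _ _)) // mulrDl lerD.
Qed.

Lemma bounded_linearZ (r : R[i]) f : bounded_linear (fun x => r *: f x).
Proof.
split=> [a x y|]; first by rewrite linearP scalerDr !scalerA mulrC.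
have [C _ fC] := bop_bounded f; exists (complex.Re `|r| * C) => x.
rewrite inormZ -mulrA ler_wpM2l //.
by case: r => a b; rewrite normc_def /= sqrtr_ge0.
Qed.

Lemma bounded_linearM f g : bounded_linear (f \o g).
Proof.
split=> [a x y|]; first by rewrite /= !linearP.
have [C C0 fC] := bop_bounded f; have [D _ gD] := bop_bounded g.
by exists (C * D) => x; rewrite (le_trans (fC _)) // -mulrA ler_wpM2l.
Qed.

Lemma bounded_linear1 : bounded_linear idfun.
Proof. by split=> [a x y //|]; exists 1 => x; rewrite mul1r. Qed.

Definition bop0 : bop := Bop (asboolT bounded_linear0).
Definition bopD f g : bop := Bop (asboolT (bounded_linearD f g)).
Definition bopZC (r : R[i]) f : bop := Bop (asboolT (bounded_linearZ r f)).
Definition bopN f : bop := bopZC (- 1) f.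
Definition bopM f g : bop := Bop (asboolT (bounded_linearM f g)).
Definition bop1 : bop := Bop (asboolT bounded_linear1).
Definition bopZ (r : R) f : bop := bopZC r%:C%C f.

Let bopDA : associative bopD.
Proof. by move=> f g h; apply: bopP => x; rewrite /= addrA. Qed.
Let bopDC : commutative bopD.
Proof. by move=> f g; apply: bopP => x; rewrite /= addrC. Qed.
Let bop0D : left_id bop0 bopD.
Proof. by move=> f; apply: bopP => x; rewrite /= add0r. Qed.
Let bopND : left_inverse bop0 bopN bopD.
Proof. by move=> f; apply: bopP => x; rewrite /= scaleN1r addNr. Qed.

HB.instance Definition _ := GRing.isZmodule.Build bop bopDA bopDC bop0D bopND.

Let bopMA : associative bopM.
Proof. by move=> f g h; apply: bopP. Qed.
Let bop1M : left_id bop1 bopM.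
Proof. by move=> f; apply: bopP. Qed.
Let bopM1 : right_id bop1 bopM.
Proof. by move=> f; apply: bopP. Qed.
Let bopMDl : left_distributive bopM bopD.
Proof. by move=> f g h; apply: bopP. Qed.
Let bopMDr : right_distributive bopM bopD.
Proof. by move=> f g h; apply: bopP => x /=; rewrite linearD. Qed.

HB.instance Definition _ :=
  GRing.Zmodule_isPzRing.Build bop bopMA bop1M bopM1 bopMDl bopMDr.

Let bopZA (r s : R) f : bopZ r (bopZ s f) = bopZ (r * s) f.
Proof. by apply: bopP => x /=; rewrite scalerA rmorphM. Qed.
Let bop1Z : left_id 1 bopZ.
Proof. by move=> f; apply: bopP => x /=; rewrite scale1r. Qed.
Let bopZDr : right_distributive bopZ +%R.
Proof. by move=> r f g; apply: bopP => x /=; rewrite scalerDr. Qed.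
Let bopZDl f : {morph bopZ^~ f : r s / r + s}.
Proof. by move=> r s; apply: bopP => x /=; rewrite rmorphD scalerDl. Qed.

HB.instance Definition _ :=
  GRing.Zmodule_isLmodule.Build R bop bopZA bop1Z bopZDr bopZDl.

Definition opnorm f : R :=
  sup [set inorm dot (f x) | x in [set x | inorm dot x <= 1]].

Let opnorm_has_sup f :
  has_sup [set inorm dot (f x) | x in [set x | inorm dot x <= 1]].
Proof.
split; first by exists (inorm dot (f 0)); exists 0 => //=; rewrite inorm0.
have [C C0 fC] := bop_bounded f; exists C => _ [x /= x1 <-].
by rewrite (le_trans (fC x)) // ler_piMr.
Qed.

Let opnorm_ub f x : inorm dot x <= 1 -> inorm dot (f x) <= opnorm f.
Proof. by move=> x1; apply: sup_upper_bound => //; exists x. Qed.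

Let opnorm_le f C :
  (forall x, inorm dot x <= 1 -> inorm dot (f x) <= C) -> opnorm f <= C.
Proof.
move=> fC; apply: ge_sup; first by case: (opnorm_has_sup f).
by move=> _ [x x1 <-]; apply: fC.
Qed.

Let inormZR (r : R) x : inorm dot (r%:C%C *: x) = `|r| * inorm dot x.
Proof. by rewrite inormZ normc_def /= expr0n addr0 sqrtr_sqr. Qed.

Lemma opnormP f x : inorm dot (f x) <= opnorm f * inorm dot x.
Proof.
have [x0|x0] := eqVneq (inorm dot x) 0.
  by rewrite (inorm_eq0 x0) linear0 inorm0 mulr0.
have {}x0 : 0 < inorm dot x by rewrite lt_neqAle eq_sym x0 inorm_ge0.
rewrite -ler_pdivrMr // mulrC -[X in X * _]gtr0_norm ?invr_gt0 //.
rewrite -inormZR -linearZ opnorm_ub // inormZR.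
by rewrite gtr0_norm ?invr_gt0 // mulVf // gt_eqF.
Qed.

Let opnorm_ge0 f : 0 <= opnorm f.
Proof. by rewrite (le_trans (inorm_ge0 dot (f 0))) // opnorm_ub ?inorm0. Qed.

Let opnormD f g : opnorm (f + g) <= opnorm f + opnorm g.
Proof.
apply: opnorm_le => x x1; rewrite (le_trans (inormD _ _ _)) //.
by rewrite lerD ?opnorm_ub.
Qed.

Let opnormZ_le (r : R) f : opnorm (r *: f) <= `|r| * opnorm f.
Proof.
by apply: opnorm_le => x x1; rewrite [_ x]/= inormZR ler_wpM2l ?opnorm_ub.
Qed.

Let opnormZ (r : R) f : opnorm (r *: f) = `|r| * opnorm f.
Proof.
apply/eqP; rewrite eq_le opnormZ_le /=.
have [->|r0] := eqVneq r 0; first by rewrite normr0 mul0r opnorm_ge0.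
rewrite -ler_pdivlMl ?normr_gt0 // -normfV.
by rewrite (le_trans _ (opnormZ_le _ _)) // scalerA mulVf // scale1r.
Qed.

Let opnorm_eq0 f : opnorm f = 0 -> f = 0.
Proof.
move=> f0; apply: bopP => x; apply/(@inorm_eq0 _ _ dot)/le_anti.
by rewrite inorm_ge0 andbT (le_trans (opnormP _ _)) // f0 mul0r.
Qed.

HB.instance Definition _ :=
  Lmodule_isNormed.Build R bop opnormD opnormZ opnorm_eq0.

End BoundedOperators.

Section OperatorTheory.
Variables (R : realType) (V : lmodType R[i]) (dot : inner V).
Implicit Types A B P S U W : bop dot.

(* Partially defined linear operators; the values of [lop_fun] outside of
   [dom] are irrelevant. *)
Record linop := Linop {
  dom : set V;
  lop_fun :> V -> V;
  dom0 : dom 0;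
  dom_linear : forall (a : R[i]) x y, dom x -> dom y -> dom (a *: x + y);
  lop_linear : forall (a : R[i]) x y, dom x -> dom y ->
    lop_fun (a *: x + y) = a *: lop_fun x + lop_fun y
}.

Definition linop_of_bop A : linop :=
  @Linop setT A I (fun _ _ _ _ _ => I) (fun a x y _ _ => bop_linear A a x y).

Definition graph (T : linop) : set (V * V) :=
  [set x | dom T x.1 /\ x.2 = T x.1].

Definition unbounded (T : linop) : Prop :=
  ~ exists C : R, forall x, dom T x -> inorm dot (T x) <= C * inorm dot x.

(* The operators below are selected by the property that determines them
   uniquely, with the junk value 0 if there is none. *)
Definition adj A : bop dot :=
  xget 0 [set B : bop dot | forall x y, dot (A x) y = dot x (B y)].

Definition positive A : Prop := forall x, 0 <= dot (A x) x.

Definition opabs A : bop dot :=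
  xget 0 [set S : bop dot | positive S /\ S * S = adj A * A].

Definition is_inverse A B : Prop := A * B = 1 /\ B * A = 1.

Definition invertible A : Prop := exists B, is_inverse A B.

Definition opinv A : bop dot := xget 0 [set B : bop dot | is_inverse A B].

Definition unitary U : Prop := is_inverse U (adj U).

Definition orthoproj (E : set V) : bop dot :=
  xget 0 [set P : bop dot | [/\ P * P = P, adj P = P & range P = E]].

Definition opexp A : bop dot :=
  limn (series (fun k : nat => (k`!%:R^-1 : R) *: A ^+ k)).

(* For self-adjoint [A] these power series agree with the continuous functional
   calculus; [opsinc] is that of sin x / x with value 1 at 0. *)
Definition opcos A : bop dot :=
  limn (series (fun k : nat => ((-1) ^+ k / (k.*2)`!%:R : R) *: A ^+ k.*2)).

Definition opsinc A : bop dot :=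
  limn (series (fun k : nat => ((-1) ^+ k / (k.*2.+1)`!%:R : R) *: A ^+ k.*2)).

Definition opsin A : bop dot := A * opsinc A.

Definition optan A : bop dot := opsin A * opinv (opcos A).

Definition partial_isometry W : Prop :=
  forall x, (forall y, W y = 0 -> dot x y = 0) -> inorm dot (W x) = inorm dot x.

Definition polar_decomposition B W : Prop :=
  [/\ partial_isometry W, (forall x, W x = 0 <-> B x = 0) & B = W * opabs B].

End OperatorTheory.

Section DirectSum.
Variables (R : realType) (V : lmodType R[i]) (dot : inner V).

Definition sum_inner (x y : V * V) : R[i] := dot x.1 y.1 + dot x.2 y.2.

Let sum_inner_bilinear :
  bilinear_for ( *%R : R[i] -> _ -> _) (@Num.conj _ \; *%R) sum_inner.
Proof.
rewrite /sum_inner; split=> [u'|u] a x y /=.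
  by rewrite !linearPl mulrDr addrACA.
by rewrite !linearPr /= mulrDr addrACA.
Qed.

HB.instance Definition _ :=
  bilinear_isBilinear.Build R[i] _ _ _ _ _ sum_inner sum_inner_bilinear.

Let sum_inner_hermitian x y :
  sum_inner x y = (-1) ^+ false * (sum_inner y x)^*.
Proof.
have dotC u v : dot u v = (dot v u)^* by rewrite hermC expr0 mul1r.
by rewrite expr0 mul1r /sum_inner rmorphD /= -!dotC.
Qed.

HB.instance Definition _ :=
  isHermitianSesquilinear.Build R[i] _ _ _ sum_inner sum_inner_hermitian.

Let sum_inner_gt0 u : u != 0 -> 0 < sum_inner u u.
Proof.
case: u => u v; rewrite /sum_inner /= => uv.
have [u0|/(@neq0_dnorm_gt0 _ _ _ dot) u0] := eqVneq u 0; last first.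
  by rewrite ltr_wpDr // dot_ge0.
rewrite ltr_wpDl ?dot_ge0 // neq0_dnorm_gt0 //.
by apply: contra_neq uv => ->; rewrite u0.
Qed.

HB.instance Definition _ := isDotProduct.Build R[i] _ sum_inner sum_inner_gt0.

Lemma inorm_sum (x : V * V) :
  inorm sum_inner x ^+ 2 = inorm dot x.1 ^+ 2 + inorm dot x.2 ^+ 2.
Proof. by rewrite !inorm2 /sum_inner raddfD. Qed.

Lemma bounded_linear_block (A B C D : bop dot) :
  bounded_linear sum_inner (fun x => (A x.1 + B x.2, C x.1 + D x.2)).
Proof.
split=> [a x y|]; first by congr (_, _); rewrite /= !linearP scalerDr addrACA.
have n1 z : inorm dot z.1 <= inorm sum_inner z.
  rewrite -(@ler_pXn2r _ 2) ?nnegrE ?inorm_ge0 // inorm_sum.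
  by rewrite lerDl exprn_ge0 ?inorm_ge0.
have n2 z : inorm dot z.2 <= inorm sum_inner z.
  rewrite -(@ler_pXn2r _ 2) ?nnegrE ?inorm_ge0 // inorm_sum.
  by rewrite lerDr exprn_ge0 ?inorm_ge0.
have n12 z : inorm sum_inner z <= inorm dot z.1 + inorm dot z.2.
  rewrite -(@ler_pXn2r _ 2) ?nnegrE ?addr_ge0 ?inorm_ge0 // inorm_sum sqrrD.
  by rewrite addrAC lerDl mulrn_wge0 // mulr_ge0 ?inorm_ge0.
have bnd (M N : bop dot) : exists K : R, forall z : V * V,
    inorm dot (M z.1 + N z.2) <= K * inorm sum_inner z.
  have [K K0 MK] := bop_bounded M; have [L L0 NL] := bop_bounded N.
  exists (K + L) => z; rewrite (le_trans (inormD _ _ _)) // mulrDl lerD //.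
    by rewrite (le_trans (MK _)) // ler_wpM2l.
  by rewrite (le_trans (NL _)) // ler_wpM2l.
have [K AB] := bnd A B; have [L CD] := bnd C D.
exists (K + L) => z; rewrite (le_trans (n12 _)) // mulrDl.
by apply: lerD; [exact: AB|exact: CD].
Qed.

Definition block (A B C D : bop dot) : bop sum_inner :=
  Bop (asboolT (bounded_linear_block A B C D)).

End DirectSum.

Section Curves.
Variables (R : realType) (W : normedModType R).
Implicit Types (c : R -> W) (a b : R).

(* The second condition says that the derivative in the open interval extends
   continuously to the closed one. *)
Definition C1_on c a b : Prop :=
  {within `[a, b], continuous c} /\
  exists2 g : R -> W, {within `[a, b], continuous g} &
    forall t, t \in `]a, b[ -> is_derive t 1 c (g t).

Definition piecewise_C1 c a b : Prop :=
  exists2 s : seq R, itv_partition a b s &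
    forall k, (k < size s)%N -> C1_on c (nth b (a :: s) k) (nth b (a :: s) k.+1).

Definition length c a b : \bar R :=
  (\int[lebesgue_measure]_(t in `[a, b]) (`|derive1 c t|)%:E)%E.

End Curves.

Section RiemannSphere.
Variables (R : realType) (V : lmodType R[i]) (dot : inner V).

Let BB := bop (sum_inner dot).
Implicit Types (p q X : BB) (c : R -> BB) (a b t : R).

Definition base_proj : BB := block 1 0 0 0.

Definition riemann_sphere : set BB :=
  [set p | exists2 u, unitary u & p = u * base_proj * adj u].

Definition tangent p X : Prop := adj X = X /\ X * p + p * X = X.

Definition sphere_curve c a b : Prop :=
  piecewise_C1 c a b /\ forall t, t \in `[a, b] -> riemann_sphere (c t).

Definition dist p q : \bar R :=
  ereal_inf [set l | exists c a b,
    [/\ a <= b, sphere_curve c a b, c a = p, c b = q & l = length c a b]].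

(* Only the values of [c] on [0, 1] matter, here and below. *)
Definition geodesic c : Prop :=
  exists2 X, tangent (c 0) X &
    let Y := X * c 0 - c 0 * X in
    forall t, t \in `[0, 1] -> c t = opexp (t *: Y) * c 0 * opexp (- (t *: Y)).

Definition minimal_geodesic c : Prop :=
  geodesic c /\ length c 0 1 = dist (c 0) (c 1).

Definition PGr (T : linop V) : BB := orthoproj (sum_inner dot) (graph T).

Definition bounded_deformation (T : linop V) (alpha : R) (Tt : R -> bop dot) :=
  [/\ 0 < alpha, {within `[0, alpha[, continuous Tt} &
      dist (PGr (linop_of_bop (Tt t))) (PGr T) @[t --> alpha^'-] --> 0%E].

Definition deformation_curve (T : linop V) (alpha : R) (Tt : R -> bop dot) t :=
  if t < alpha then PGr (linop_of_bop (Tt t)) else PGr T.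

Definition optimal (T : linop V) (alpha : R) (Tt : R -> bop dot) : Prop :=
  let p := deformation_curve T alpha Tt in
  forall t0, t0 \in `[0, alpha[ ->
    sphere_curve p t0 alpha /\ length p t0 alpha = dist (p t0) (p alpha).

End RiemannSphere.

(* B(H) and B(H (+) H) for a Hilbert space H. The direct sum H * H carries the
   inner product [sum_inner]; its library norm is the maximum norm, which
   defines the same topology but is not used for the operator norm. *)
Notation BH H := (bop (@hdot _ H)).
Notation BHH H := (bop (sum_inner (@hdot _ H))).

(* Main.v *)
Require Import Defs.
From HB Require Import structures.
From mathcomp Require Import all_boot all_order all_algebra complex.
From mathcomp Require Import all_classical all_reals all_analysis.
From mathcomp Require Import measurable_realfun ring lra.

Set Implicit Arguments.
Unset Strict Implicit.
Unset Printing Implicit Defensive.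

Import Order.TTheory GRing.Theory Num.Theory.
Import numFieldNormedType.Exports.

Local Open Scope classical_set_scope.
Local Open Scope ring_scope.

(* The curve [gamma t = E t * p0 * E (- t)], with [E t] the exponential of [t Y]
   and [Y = X p0 - p0 X], has constant speed [`|X|].  With [rho = 2 p0 - 1] the
   self-adjoint unitary [w = E 1 * rho] satisfies [w p0 w = gamma 1], and the
   rotations by [i w] carry [p0] to [gamma 1] along a curve of length at most
   [pi / 2]; minimality therefore forces [`|X| <= pi / 2].  The compression of
   [E t] to the first summand is [cos |t a^*|].  Since [rho] reverses time, a
   lower bound [m >= 0] for it at [t] gives [2 m ^ 2 - 1] at [2 t]; starting
   from small times this bounds it below by a positive constant for [t < 1], so
   it is invertible and the range of [gamma t] is a graph.  Optimality of the
   tails of [gamma] follows from its minimality and the triangle inequality, by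
   concatenation of curves. *)

(** With a continuous functional calculus, [|a| <= pi / 2] would make [cos |t a^*|] invertible for
    [t < 1] at once. The proof works with norm-convergent series instead and replaces the spectral
    bound by a bound on the numerical range: an operator [C] of norm at most 1 with
    [Re <C x, x> >= c |x|^2] for some [c > 0] is inverted by a Neumann series. Doubling such bounds
    is the recursion of the cosine, so [cos (v / 2^n)] at time [t / 2^n] grows into [cos v] at time
    [t]. At small times the exponential series only yields the defect [exp (t |Y|) - 1], slightly
    more than [t |Y|]; an angle [v] strictly between [t |Y|] and [pi / 2] absorbs the excess, and
    this room is what [t < 1] provides. The values of [adj], [opabs], [opinv] and [orthoproj] are
    choices with default 0, so each is identified before it is used: adjoints and inverses by
    exhibiting them, absolute values by constructing a positive square root and proving it unique,
    graph projections by their range. *)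

Section Operators.
Variables (R : realType) (V : lmodType R[i]) (dot : inner V).
Implicit Types (x y : V) (A B C M N : bop dot) (r s : R).

Lemma bopDE A B x : (A + B) x = A x + B x. Proof. by []. Qed.
Lemma bopNE A x : (- A) x = - A x. Proof. exact: scaleN1r. Qed.
Lemma bopBE A B x : (A - B) x = A x - B x. Proof. by rewrite bopDE bopNE. Qed.
Lemma bopME A B x : (A * B) x = A (B x). Proof. by []. Qed.
Lemma bop1E x : (1 : bop dot) x = x. Proof. by []. Qed.
Lemma bop0E x : (0 : bop dot) x = 0. Proof. by []. Qed.
Lemma bopZE r A x : (r *: A) x = r%:C%C *: A x. Proof. by []. Qed.

Lemma bopZAl r A B : r *: (A * B) = (r *: A) * B.
Proof. by apply: bopP. Qed.

Lemma bopZAr r A B : r *: (A * B) = A * (r *: B).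
Proof. by apply: bopP => x; rewrite bopZE !bopME bopZE linearZ. Qed.

Lemma bopXZ r A k : (r *: A) ^+ k = r ^+ k *: A ^+ k.
Proof.
elim: k => [|k IH]; first by rewrite !expr0 scale1r.
by rewrite !exprS IH -bopZAl -bopZAr scalerA.
Qed.

Lemma inormN x : inorm dot (- x) = inorm dot x.
Proof. by rewrite -scaleN1r inormZ normrN1 /= mul1r. Qed.

Lemma bop_normE A x : inorm dot (A x) <= `|A| * inorm dot x.
Proof. exact: opnormP. Qed.

Lemma bop_norm_le A r : 0 <= r ->
  (forall x, inorm dot (A x) <= r * inorm dot x) -> `|A| <= r.
Proof.
move=> r0 Ar; apply: ge_sup.
  by exists (inorm dot (A 0)); exists 0 => //=; rewrite inorm0.
by move=> _ [x /= x1 <-]; rewrite (le_trans (Ar x)) // ler_piMr.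
Qed.

Lemma bop_normM A B : `|A * B| <= `|A| * `|B|.
Proof.
apply: bop_norm_le => [|x]; first by rewrite mulr_ge0.
rewrite bopME -mulrA; apply: le_trans (bop_normE A (B x)) _.
by rewrite ler_wpM2l ?bop_normE.
Qed.

Lemma bop_norm1 : `|1 : bop dot| <= 1.
Proof. by apply: bop_norm_le => // x; rewrite mul1r. Qed.

Lemma bop_normX A k : `|A ^+ k| <= `|A| ^+ k.
Proof.
elim: k => [|k IH]; first by rewrite !expr0 bop_norm1.
by rewrite !exprS (le_trans (bop_normM _ _)) // ler_wpM2l.
Qed.

Lemma bop_cvgM (T : Type) (F : set_system T) {FF : Filter F}
    (f g : T -> bop dot) A B :
  f @ F --> A -> g @ F --> B -> (fun t => f t * g t) @ F --> A * B.
Proof.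
move=> fA gB; apply/subr_cvg0/norm_cvg0P.
have lim0 : `|f t| * `|g t - B| + `|f t - A| * `|B| @[t --> F] --> (0 : R).
  have -> : 0 = `|A| * 0 + 0 * `|B| :> R by rewrite mulr0 mul0r addr0.
  apply: cvgD; apply: cvgM.
  - exact: cvg_norm.
  - exact/norm_cvg0P/subr_cvg0.
  - exact/norm_cvg0P/subr_cvg0.
  - exact: cvg_cst.
apply: squeeze_cvgr (cvg_cst _) lim0; apply: nearW => t.
rewrite normr_ge0 /=.
have -> : f t * g t - A * B = f t * (g t - B) + (f t - A) * B.
  by rewrite mulrBr mulrBl addrA subrK.
by rewrite (le_trans (ler_normD _ _)) // lerD // bop_normM.
Qed.

Lemma bop_cvg_norm_le (T : Type) (F : set_system T) {FF : ProperFilter F}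
    (f : T -> bop dot) A r :
  f @ F --> A -> (\forall t \near F, `|f t| <= r) -> `|A| <= r.
Proof. by move=> fA; apply: cvgr_to_le; exact: cvg_norm. Qed.

End Operators.

(** * Completeness of the inner product and of the bounded operators *)

Section Completeness.
Variables (R : realType).

(** Stated through [dot] alone, so that it applies to [sum_inner], whose norm is not the one that
    [H * H] already carries. *)
Definition inner_cvg (V : lmodType R[i]) (dot : inner V) (u : nat -> V) (l : V) :=
  inorm dot (u n - l) @[n --> \oo] --> (0 : R).

Definition inner_complete (V : lmodType R[i]) (dot : inner V) : Prop :=
  forall u : nat -> V,
    (forall e : R, 0 < e -> exists N, forall m n, (N <= m)%N -> (N <= n)%N ->
      inorm dot (u m - u n) <= e) ->
    exists l, inner_cvg dot u l.

Lemma hilbert_norm (H : hilbertType R) (x : H) : `|x| = (inorm hdot x)%:C%C.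
Proof.
apply/eqP; rewrite -(@eqrXn2 _ 2) //; last first.
  by rewrite lecE /= eqxx inorm_ge0.
rewrite hdot_norm -rmorphXn /= inorm2 RRe_real //.
by rewrite ger0_real // dot_ge0.
Qed.

Lemma hilbert_complete (H : hilbertType R) : inner_complete (@hdot _ H).
Proof.
move=> u uC; have /cvg_ex[l ul] : cvgn u.
  apply/cauchy_cvgP/cauchy_exP => e e0.
  have er : e = (complex.Re e)%:C%C by rewrite [RHS]RRe_real // gtr0_real.
  have e1 : 0 < complex.Re e by move: e0; rewrite er ltcR.
  have e20 : 0 < complex.Re e / 2 by rewrite divr_gt0.
  have [N uN] := uC _ e20.
  exists (u N); exists N => //= n Nn; rewrite -ball_normE /= hilbert_norm er ltcR.
  rewrite (le_lt_trans (uN _ _ _ _)) //.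
  by rewrite ltr_pdivrMr // ltr_pMr ?ltr1n.
exists l; apply/cvgrPdist_le => e e0.
have e0C : 0 < e%:C%C :> R[i] by rewrite ltcR.
near=> n; rewrite sub0r normrN ger0_norm ?inorm_ge0 //.
rewrite -lecR -hilbert_norm -normrN opprB; near: n.
by move/cvgrPdist_le : ul; apply.
Unshelve. all: by end_near. Qed.

Variables (V : lmodType R[i]) (dot : inner V).
Implicit Types (x y : V) (u v : nat -> V).

Lemma inner_cvg_unique u x y : inner_cvg dot u x -> inner_cvg dot u y -> x = y.
Proof.
move=> ux uy; apply/eqP; rewrite -subr_eq0; apply/eqP/(@inorm_eq0 _ _ dot).
apply/le_anti; rewrite inorm_ge0 andbT.
have uxy : inorm dot (u n - x) + inorm dot (u n - y) @[n --> \oo] --> (0 : R).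
  by rewrite -[0]addr0; apply: cvgD.
apply: (cvgr_to_ge uxy); apply: nearW => n.
rewrite -[inorm _ (u n - x)]inormN opprB.
by rewrite (le_trans _ (inormD _ _ _)) // addrA subrK.
Qed.

Lemma inner_cvg_lin (a : R[i]) u v x y :
  inner_cvg dot u x -> inner_cvg dot v y ->
  inner_cvg dot (fun n => a *: u n + v n) (a *: x + y).
Proof.
move=> ux vy; apply: squeeze_cvgr (cvg_cst _) (_ : (fun n =>
  complex.Re `|a| * inorm dot (u n - x) + inorm dot (v n - y)) @ \oo --> _).
  apply: nearW => n; rewrite inorm_ge0 /= -inormZ.
  by rewrite opprD addrACA -scalerBr inormD.
by rewrite -[0]addr0; apply: cvgD => //; rewrite -(mulr0 (complex.Re `|a|));
  apply: cvgMl_tmp.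
Qed.

Lemma inorm_fst_le (x : V * V) : inorm dot x.1 <= inorm (sum_inner dot) x.
Proof.
rewrite -(@ler_pXn2r _ 2) ?nnegrE ?inorm_ge0 // inorm_sum.
by rewrite lerDl exprn_ge0 ?inorm_ge0.
Qed.

Lemma inorm_snd_le (x : V * V) : inorm dot x.2 <= inorm (sum_inner dot) x.
Proof.
rewrite -(@ler_pXn2r _ 2) ?nnegrE ?inorm_ge0 // inorm_sum.
by rewrite lerDr exprn_ge0 ?inorm_ge0.
Qed.

Lemma inorm_sum_le (x : V * V) :
  inorm (sum_inner dot) x <= inorm dot x.1 + inorm dot x.2.
Proof.
rewrite -(@ler_pXn2r _ 2) ?nnegrE ?addr_ge0 ?inorm_ge0 // inorm_sum sqrrD.
by rewrite addrAC lerDl mulrn_wge0 // mulr_ge0 ?inorm_ge0.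
Qed.

Lemma sum_inner_complete : inner_complete dot -> inner_complete (sum_inner dot).
Proof.
move=> dotC u uC.
have [|l1 ul1] := dotC (fst \o u).
  move=> e /uC[N uN]; exists N => m n Nm Nn.
  exact: le_trans (inorm_fst_le (u m - u n)) (uN _ _ Nm Nn).
have [|l2 ul2] := dotC (snd \o u).
  move=> e /uC[N uN]; exists N => m n Nm Nn.
  exact: le_trans (inorm_snd_le (u m - u n)) (uN _ _ Nm Nn).
exists (l1, l2); apply: squeeze_cvgr (cvg_cst _) (_ : (fun n =>
  inorm dot ((u n).1 - l1) + inorm dot ((u n).2 - l2)) @ \oo --> _).
  by apply: nearW => n; rewrite inorm_ge0 (inorm_sum_le (u n - (l1, l2))).
by rewrite -[0]addr0; apply: cvgD.
Qed.

Hypothesis dotC : inner_complete dot.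

(** The limit is taken pointwise; letting [m] tend to infinity in the Cauchy estimate gives a bound
    uniform in [x], hence both boundedness of the limit and convergence in norm. *)
Lemma bop_cauchy_cvg (f : nat -> bop dot) :
  (forall e : R, 0 < e -> exists N, forall m n, (N <= m)%N -> (N <= n)%N ->
      `|f m - f n| <= e) -> cvgn f.
Proof.
move=> fC.
have lim x : {l : V | inner_cvg dot (fun n => f n x) l}.
  apply/cid/dotC => e e0.
  (* The summand 1 keeps the denominator positive at [x = 0]. *)
  have d0 : 0 < e / (1 + inorm dot x) by rewrite divr_gt0 // ltr_wpDr ?inorm_ge0.
  have [N fN] := fC _ d0; exists N => m n Nm Nn.
  rewrite -bopBE (le_trans (bop_normE _ _)) //.
  rewrite (le_trans (ler_wpM2r (inorm_ge0 _ _) (fN _ _ Nm Nn))) //.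
  rewrite -mulrA ler_piMr // ?(ltW e0) // mulrC ler_pdivrMr.
    by rewrite mul1r lerDr.
  by rewrite ltr_wpDr ?inorm_ge0.
pose g x := projT1 (lim x).
have gP x : inner_cvg dot (fun n => f n x) (g x) := projT2 (lim x).
have glin : linear g.
  move=> a x y; apply: inner_cvg_unique (gP _) _.
  rewrite (_ : (fun n => _) = (fun n => a *: f n x + f n y)).
    exact: inner_cvg_lin.
  by apply/funext => n; rewrite linearP.
have gle e : 0 < e -> exists N, forall n, (N <= n)%N -> forall x,
    inorm dot (f n x - g x) <= e * inorm dot x.
  move=> /fC[N fN]; exists N => n Nn x.
  have fg : e * inorm dot x + inorm dot (f m x - g x) @[m --> \oo] -->
      e * inorm dot x.
    by rewrite -[X in _ --> X]addr0; apply: cvgD; [exact: cvg_cst|exact: gP].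
  apply: (cvgr_to_ge fg); exists N => // m Nm.
  have -> : f n x - g x = (f n - f m) x + (f m x - g x).
    by rewrite bopBE addrA subrK.
  rewrite (le_trans (inormD _ _ _)) // lerD2r (le_trans (bop_normE _ _)) //.
  by rewrite ler_wpM2r ?inorm_ge0 ?fN.
have gbnd : bounded_linear dot g.
  split=> //; have [N /(_ N (leqnn N)) gN] := gle 1 ltr01.
  exists (1 + `|f N|) => x; rewrite mulrDl mul1r.
  rewrite -[g x](subrK (f N x)) (le_trans (inormD _ _ _)) // lerD ?bop_normE //.
  by rewrite -inormN opprB -[leRHS]mul1r gN.
apply/cvg_ex; exists (Bop (asboolT gbnd)).
apply/cvgrPdist_le => e e0; have [N gN] := gle _ e0; exists N => // n Nn.
by rewrite distrC; apply: bop_norm_le => [|x]; [exact: ltW|rewrite bopBE gN].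
Qed.

Lemma bop_cvg_pointwise (f : nat -> bop dot) (A : bop dot) x :
  f n @[n --> \oo] --> A -> inner_cvg dot (fun n => f n x) (A x).
Proof.
move=> /subr_cvg0/norm_cvg0P fA; apply: squeeze_cvgr (cvg_cst _) (_ : (fun n =>
  `|f n - A| * inorm dot x) @ \oo --> _).
  by apply: nearW => n; rewrite inorm_ge0 -bopBE bop_normE.
by rewrite -(mul0r (inorm dot x)); apply: cvgMr_tmp.
Qed.

(** Weierstrass majorant test, through which every operator series below is shown to converge. *)
Lemma bop_series_cvg (f : nat -> bop dot) (r : nat -> R) :
  (forall k, `|f k| <= r k) -> cvgn (series r) -> cvgn (series f).
Proof.
move=> fr /cauchy_cvgP/cauchy_seriesP rC; apply: bop_cauchy_cvg => e e0.
have [[S1 S2] [[N1 _ N1S] [N2 _ N2S]] SS] := rC e e0.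
pose N := maxn N1 N2.
have tail m n : (N <= m)%N -> (m <= n)%N -> `|series f n - series f m| <= e.
  rewrite geq_max => /andP[m1 m2] mn; rewrite sub_series_geq //.
  have n2 : (N2 <= n)%N by exact: leq_trans mn.
  have /ltW := SS (m, n) (conj (N1S _ m1) (N2S _ n2)).
  apply: le_trans; rewrite (le_trans (ler_norm_sum _ _ _)) //.
  by rewrite (le_trans _ (ler_norm _)) // ler_sum.
exists N => m n Nm Nn; have [mn|/ltnW nm] := leqP m n; last exact: tail.
by rewrite distrC tail.
Qed.

End Completeness.

(** * Cauchy products of partial sums *)

Section CauchyProduct.

(** Meant for a product of two partial sums: the first term on the right is the partial sum of their
    Cauchy product, the second the remainder to be estimated. *)
Lemma big_triangle (W : nmodType) (F : nat -> nat -> W) n :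
  \sum_(i < n) \sum_(j < n) F i j =
  \sum_(k < n) \sum_(i < k.+1) F i (k - i)%N +
  \sum_(i < n) \sum_(j < n | (n <= i + j)%N) F i j.
Proof.
have -> : \sum_(k < n) \sum_(i < k.+1) F i (k - i)%N =
    \sum_(i < n) \sum_(j < n | (i + j < n)%N) F i j.
  transitivity (\sum_(k < n) \sum_(i < n | (i < k.+1)%N) F i (k - i)%N).
    by apply: eq_bigr => k _; rewrite (big_ord_widen n (fun i => F i (k - i)%N)).
  rewrite (exchange_big_dep xpredT) //=; apply: eq_bigr => i _.
  transitivity (\sum_(i <= k < n) F i (k - i)%N).
    rewrite big_geq_mkord; apply: eq_bigl => k.
    by rewrite ltnS.
  rewrite -{1}[val i]add0n big_addn big_mkord.
  rewrite (big_ord_widen n (fun k => F i (k + i - i)%N)) ?leq_subr //.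
  apply: eq_big => [j|j _]; first by rewrite ltn_subRL.
  by rewrite addnK.
rewrite -big_split /=; apply: eq_bigr => i _.
rewrite (bigID (fun j : 'I_n => (i + j < n)%N)) /=; congr (_ + _).
by apply: eq_bigl => j; rewrite -leqNgt.
Qed.

Lemma exp_coeffD (R : realType) (s t : R) k :
  \sum_(i < k.+1) exp_coeff s i * exp_coeff t (k - i)%N = exp_coeff (s + t) k.
Proof.
rewrite /exp_coeff /= addrC exprDn mulr_suml; apply: eq_bigr => i _.
have ik : (i <= k)%N by rewrite -ltnS.
rewrite -mulr_natl -(bin_fact ik) !natrM.
have n0 m : m`!%:R != 0 :> R by rewrite pnatr_eq0 -lt0n fact_gt0.
have b0 : 'C(k, i)%:R != 0 :> R by rewrite pnatr_eq0 -lt0n bin_gt0.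
field; rewrite !n0.
by apply/and3P; split.
Qed.

End CauchyProduct.

(** * The operator exponential *)

Section Exponential.
Variables (R : realType) (V : lmodType R[i]) (dot : inner V).
Hypothesis dotC : inner_complete dot.
Implicit Types (A B Y : bop dot) (r s t : R).

Lemma opexp_termE t Y k :
  (k`!%:R^-1 : R) *: (t *: Y) ^+ k = exp_coeff t k *: Y ^+ k.
Proof. by rewrite bopXZ scalerA mulrC. Qed.

Lemma opexp_cvg A :
  series (fun k => (k`!%:R^-1 : R) *: A ^+ k) @ \oo --> opexp A.
Proof.
apply: (bop_series_cvg dotC (r := exp_coeff `|A|)) => [k|].
  rewrite normrZ ger0_norm // mulrC ler_wpM2r //; exact: bop_normX.
exact: is_cvg_series_exp_coeff.
Qed.

Lemma opexpZ_cvg t Y :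
  series (fun k => exp_coeff t k *: Y ^+ k) @ \oo --> opexp (t *: Y).
Proof.
rewrite (_ : (fun k => _) = (fun k => (k`!%:R^-1 : R) *: (t *: Y) ^+ k)).
  exact: opexp_cvg.
by apply/funext => k; rewrite opexp_termE.
Qed.

Lemma opexpZ_cvg_ord t Y :
  \sum_(k < n) exp_coeff t k *: Y ^+ k @[n --> \oo] --> opexp (t *: Y).
Proof.
rewrite (_ : (fun n => _) = series (fun k => exp_coeff t k *: Y ^+ k)).
  exact: opexpZ_cvg.
by apply/funext => n; rewrite /series /= big_mkord.
Qed.

Lemma expR_cvg_ord t : \sum_(k < n) exp_coeff t k @[n --> \oo] --> expR t.
Proof.
rewrite (_ : (fun n => _) = series (exp_coeff t)).
  exact: is_cvg_series_exp_coeff.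
by apply/funext => n; rewrite /series /= big_mkord.
Qed.

Lemma norm_exp_coeff t k : `|exp_coeff t k| = exp_coeff `|t| k.
Proof.
by rewrite /exp_coeff /= normrM normrX [`|_^-1|]ger0_norm.
Qed.

Lemma opexp0 : opexp (0 : bop dot) = 1.
Proof.
rewrite -(scale0r (1 : bop dot)); apply: (cvg_unique _ (@opexpZ_cvg_ord 0 1)) => //.
apply/cvgrPdist_le => e e0; exists 1%N => // n; case: n => // n _.
rewrite big_ord_recl big1 ?addr0 => [|i _].
  by rewrite /exp_coeff /= divr1 scale1r subrr normr0 ltW.
by rewrite /exp_coeff /= expr0n mul0r scale0r.
Qed.

(** The remainder of the Cauchy product over [n <= i + j] is dominated term by term by the one for
    the real exponentials at [|s| * |Y|] and [|t| * |Y|], which tends to 0 by the addition law of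
    [expR]. *)
Lemma opexpD s t Y : opexp ((s + t) *: Y) = opexp (s *: Y) * opexp (t *: Y).
Proof.
apply/eqP; rewrite eq_sym -subr_eq0 -normr_le0.
pose S r n := \sum_(k < n) exp_coeff r k *: Y ^+ k.
pose E r n := \sum_(k < n) exp_coeff r k.
have Slim : S s n * S t n - S (s + t) n @[n --> \oo] -->
    opexp (s *: Y) * opexp (t *: Y) - opexp ((s + t) *: Y).
  by apply: cvgB; [apply: bop_cvgM|]; exact: opexpZ_cvg_ord.
set a := `|s| * `|Y|; set b := `|t| * `|Y|.
have Elim : E a n * E b n - E (a + b) n @[n --> \oo] --> (0 : R).
  rewrite -(subrr (expR (a + b))) [X in X - _]expRD.
  by apply: cvgB; [apply: cvgM|]; exact: expR_cvg_ord.
apply: (ler_cvg_to (cvg_norm Slim) Elim); apply: nearW => n /=.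
have -> : S s n * S t n - S (s + t) n = \sum_(i < n) \sum_(j < n | (n <= i + j)%N)
    (exp_coeff s i * exp_coeff t j) *: Y ^+ (i + j).
  apply/eqP; rewrite subr_eq addrC; apply/eqP.
  rewrite /S mulr_suml.
  transitivity (\sum_(i < n) \sum_(j < n)
      (exp_coeff s i * exp_coeff t j) *: Y ^+ (i + j)).
    apply: eq_bigr => i _; rewrite mulr_sumr; apply: eq_bigr => j _.
    by rewrite -bopZAl -bopZAr scalerA exprD.
  rewrite (big_triangle (fun i j => (exp_coeff s i * exp_coeff t j) *: Y ^+ (i + j))).
  congr (_ + _); apply: eq_bigr => k _; rewrite -exp_coeffD scaler_suml.
  by apply: eq_bigr => i _; rewrite subnKC // -ltnS.
have -> : E a n * E b n - E (a + b) n = \sum_(i < n) \sum_(j < n | (n <= i + j)%N)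
    exp_coeff a i * exp_coeff b j.
  apply/eqP; rewrite subr_eq addrC; apply/eqP; rewrite /E mulr_suml.
  transitivity (\sum_(i < n) \sum_(j < n) exp_coeff a i * exp_coeff b j).
    by apply: eq_bigr => i _; rewrite mulr_sumr.
  rewrite (big_triangle (fun i j => exp_coeff a i * exp_coeff b j)).
  by congr (_ + _); apply: eq_bigr => k _; rewrite -exp_coeffD.
rewrite (le_trans (ler_norm_sum _ _ _)) // ler_sum // => i _.
rewrite (le_trans (ler_norm_sum _ _ _)) // ler_sum // => j _.
rewrite normrZ normrM !norm_exp_coeff /exp_coeff /= !exprMn.
rewrite [X in _ <= X](_ : _ = `|s| ^+ i / i`!%:R * (`|t| ^+ j / j`!%:R) * `|Y| ^+ (i + j)).
  by rewrite ler_wpM2l ?bop_normX // !mulr_ge0.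
by rewrite exprD; ring.
Qed.

(** For [|t| <= 1] a factor [t ^+ 2] splits off every term of degree at least 2; this estimate
    differentiates the exponential at 0. *)
Lemma opexp_quadratic t Y : `|t| <= 1 ->
  `|opexp (t *: Y) - 1 - t *: Y| <= t ^+ 2 * expR `|Y|.
Proof.
move=> t1.
have lim1 : \sum_(k < n) exp_coeff t k *: Y ^+ k - 1 - t *: Y @[n --> \oo] -->
    opexp (t *: Y) - 1 - t *: Y.
  apply: cvgB; last exact: cvg_cst.
  by apply: cvgB; [exact: opexpZ_cvg_ord|exact: cvg_cst].
have lim2 : t ^+ 2 * \sum_(k < n) exp_coeff `|Y| k @[n --> \oo] -->
    t ^+ 2 * expR `|Y|.
  by apply: cvgMl_tmp; exact: expR_cvg_ord.
apply: (ler_cvg_to (cvg_norm lim1) lim2); exists 2%N => // -[|[|n]] // _ /=.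
have e0 r : exp_coeff r 0 = 1 :> R by rewrite /exp_coeff /= divr1.
have e1 r : exp_coeff r 1 = r :> R by rewrite /exp_coeff /= divr1.
rewrite !big_ord_recl /= !e0 !e1 expr0 expr1 scale1r.
rewrite [1 + (t *: Y + _)]addrC addrK [t *: Y + _]addrC addrK.
rewrite (le_trans (ler_norm_sum _ _ _)) // addrA mulrDr mulr_sumr.
rewrite ler_wpDl //; first by rewrite mulr_ge0 ?sqr_ge0 ?addr_ge0.
rewrite ler_sum // => k _.
rewrite normrZ norm_exp_coeff /exp_coeff /= /bump /= !add1n.
rewrite -[t ^+ 2]real_normK ?num_real // [`|t| ^+ k.+2](exprD _ 2 k).
set c := _^-1; set y := `|Y ^+ _|; set z := `|Y| ^+ _.
have -> : `|t| ^+ 2 * `|t| ^+ k * c * y = `|t| ^+ 2 * (c * (`|t| ^+ k * y)) by ring.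
apply: ler_wpM2l; first exact: exprn_ge0.
rewrite [z * c]mulrC; apply: ler_wpM2l; first by rewrite invr_ge0.
rewrite -[z]mul1r; apply: ler_pM.
- exact: exprn_ge0.
- exact: normr_ge0.
- by rewrite exprn_ile1.
- exact: bop_normX.
Qed.

(** As a function of [|t|] the majorant has slope [|Y|] at 0, the sharpness on which the comparison
    with the sine in [expR_sin_small] depends. *)
Lemma opexp_sub1 t Y : `|opexp (t *: Y) - 1| <= expR (`|t| * `|Y|) - 1.
Proof.
have lim1 : \sum_(k < n) exp_coeff t k *: Y ^+ k - 1 @[n --> \oo] -->
    opexp (t *: Y) - 1.
  by apply: cvgB; [exact: opexpZ_cvg_ord|exact: cvg_cst].
have lim2 : \sum_(k < n) exp_coeff (`|t| * `|Y|) k - 1 @[n --> \oo] -->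
    expR (`|t| * `|Y|) - 1.
  by apply: cvgB; [exact: expR_cvg_ord|exact: cvg_cst].
apply: (ler_cvg_to (cvg_norm lim1) lim2); exists 1%N => // -[|n] // _ /=.
have e0 r : exp_coeff r 0 = 1 :> R by rewrite /exp_coeff /= divr1.
rewrite !big_ord_recl /= !e0 expr0 scale1r.
rewrite [1 + \sum_(_ < _) _ *: _]addrC addrK [1 + _]addrC addrK.
rewrite (le_trans (ler_norm_sum _ _ _)) // ler_sum // => k _.
rewrite normrZ norm_exp_coeff /exp_coeff /= exprMn mulrAC.
rewrite ler_wpM2r ?invr_ge0 // ler_wpM2l ?exprn_ge0 //; exact: bop_normX.
Qed.

(** Moving [A] past [Y ^+ k] costs the sign [(-1) ^+ k], which [t ^+ k] absorbs as a reversal of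
    time. Meant for [A = rho]. *)
Lemma opexp_anticomm A Y t : A * Y = - (Y * A) ->
  A * opexp (t *: Y) = opexp (- t *: Y) * A.
Proof.
move=> AY.
have lim1 : A * \sum_(k < n) exp_coeff t k *: Y ^+ k @[n --> \oo] -->
    A * opexp (t *: Y).
  by apply: bop_cvgM; [exact: cvg_cst|exact: opexpZ_cvg_ord].
have lim2 : (\sum_(k < n) exp_coeff (- t) k *: Y ^+ k) * A @[n --> \oo] -->
    opexp (- t *: Y) * A.
  by apply: bop_cvgM; [exact: opexpZ_cvg_ord|exact: cvg_cst].
apply: (cvg_unique _ lim1) => //.
rewrite (_ : (fun n => _) = (fun n =>
  (\sum_(k < n) exp_coeff (- t) k *: Y ^+ k) * A)) //.
apply/funext => n; rewrite mulr_sumr mulr_suml; apply: eq_bigr => k _.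
have AYk : A * Y ^+ k = (-1 : R) ^+ k *: (Y ^+ k * A).
  elim: (val k) => [|j IH]; first by rewrite !expr0 scale1r mulr1 mul1r.
  rewrite exprSr mulrA IH -bopZAl -mulrA AY mulrN mulrA -exprSr scalerN.
  by rewrite -scaleNr [(-1) ^+ j.+1]exprS mulN1r.
rewrite -bopZAr -bopZAl AYk scalerA; congr (_ *: _).
by rewrite /exp_coeff /= (exprNn t) mulrC mulrA.
Qed.

End Exponential.

(** * Adjoints and positive operators *)

Section Adjoints.
Variables (R : realType) (V : lmodType R[i]) (dot : inner V).
Implicit Types (x y z : V) (A B C D P Q S X : bop dot) (r s : R).

Definition rdot x y : R := complex.Re (dot x y).

Lemma dot_conj x y : dot x y = (dot y x)^*.
Proof. by rewrite hermC expr0 mul1r. Qed.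

Lemma rdotC x y : rdot x y = rdot y x.
Proof.
rewrite /rdot dot_conj; apply: (@complexI R).
by rewrite !complexRe Re_conj.
Qed.

Lemma rdotDl x y z : rdot (x + y) z = rdot x z + rdot y z.
Proof. by rewrite /rdot linearDl raddfD. Qed.

Lemma rdotNl x z : rdot (- x) z = - rdot x z.
Proof. by rewrite /rdot linearNl raddfN. Qed.

Lemma rdotBl x y z : rdot (x - y) z = rdot x z - rdot y z.
Proof. by rewrite rdotDl rdotNl. Qed.

Lemma rdotZl r x z : rdot (r%:C%C *: x) z = r * rdot x z.
Proof. by rewrite /rdot linearZl_LR /=; case: (dot x z) => a b /=; ring. Qed.

Lemma rdotDr x y z : rdot z (x + y) = rdot z x + rdot z y.
Proof. by rewrite !(rdotC z) rdotDl. Qed.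

Lemma rdotNr x z : rdot z (- x) = - rdot z x.
Proof. by rewrite !(rdotC z) rdotNl. Qed.

Lemma rdotBr x y z : rdot z (x - y) = rdot z x - rdot z y.
Proof. by rewrite !(rdotC z) rdotBl. Qed.

Lemma rdotZr r x z : rdot z (r%:C%C *: x) = r * rdot z x.
Proof. by rewrite !(rdotC z) rdotZl. Qed.

Lemma rdotxx x : rdot x x = inorm dot x ^+ 2.
Proof. by rewrite inorm2. Qed.

Lemma norm_rdot x y : `|rdot x y| <= inorm dot x * inorm dot y.
Proof.
rewrite ler_norml inorm_CauchySchwarz andbT lerNl -rdotNl.
by rewrite -(inormN dot x) inorm_CauchySchwarz.
Qed.

Lemma Im_dot x y : complex.Im (dot x y) = rdot x ('i%C *: y).
Proof.
rewrite /rdot linearZr_LR /=; case: (dot x y) => a b /=.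
by ring.
Qed.

(** Used in place of [adj], whose default value carries no information: every adjoint below is
    exhibited explicitly. *)
Definition isadj A B := forall x y, dot (A x) y = dot x (B y).

(** By [Im_dot] imaginary parts are real parts at ['i *: y], and [B] commutes with the scalar
    ['i]. *)
Lemma isadj_re A B : (forall x y, rdot (A x) y = rdot x (B y)) -> isadj A B.
Proof.
move=> AB x y; apply/eqP; rewrite eq_complex; apply/andP; split; apply/eqP.
  exact: AB.
by rewrite !Im_dot AB linearZ.
Qed.

Lemma isadj_rdot A B x y : isadj A B -> rdot (A x) y = rdot x (B y).
Proof. by rewrite /rdot => ->. Qed.

Lemma adjE A B : isadj A B -> adj A = B.
Proof.
move=> AB; rewrite /adj; case: xgetP => [C _ AC|/(_ B)//].
apply: bopP => y; apply/eqP; rewrite -subr_eq0; apply/eqP/(@inorm_eq0 _ _ dot).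
apply/eqP; rewrite -sqrf_eq0 -rdotxx rdotBr /rdot -AC -AB.
by rewrite subrr.
Qed.

(** If [adj A] is the default value, the hypothesis forces [A = 0], for which the conclusion holds
    too. *)
Lemma selfadjP A : adj A = A -> isadj A A.
Proof.
rewrite /adj; case: xgetP => [C _ AC CA|_ <- x y]; first by rewrite -{2}CA.
by rewrite linear0l linear0r.
Qed.

Lemma isadj_sym A B : isadj A B -> isadj B A.
Proof. by move=> AB; apply: isadj_re => x y; rewrite rdotC -(isadj_rdot _ _ AB) rdotC. Qed.

Lemma isadj0 : isadj 0 0.
Proof. by move=> x y; rewrite !bop0E linear0l linear0r. Qed.

Lemma isadj1 : isadj 1 1. Proof. by []. Qed.

Lemma isadjD A B C D : isadj A B -> isadj C D -> isadj (A + C) (B + D).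
Proof.
by move=> AB CD x y; rewrite !bopDE linearDl linearDr /= AB CD.
Qed.

Lemma isadjZ r A B : isadj A B -> isadj (r *: A) (r *: B).
Proof.
move=> AB; apply: isadj_re => x y.
by rewrite !bopZE rdotZl rdotZr (isadj_rdot _ _ AB).
Qed.

Lemma isadjN A B : isadj A B -> isadj (- A) (- B).
Proof.
move=> AB; apply: isadj_re => x y.
by rewrite !bopNE rdotNl rdotNr (isadj_rdot _ _ AB).
Qed.

Lemma isadjB A B C D : isadj A B -> isadj C D -> isadj (A - C) (B - D).
Proof. by move=> AB CD; apply: isadjD => //; apply: isadjN. Qed.

Lemma isadjM A B C D : isadj A B -> isadj C D -> isadj (A * C) (D * B).
Proof. by move=> AB CD x y; rewrite !bopME AB CD. Qed.

Lemma isadjX A B k : isadj A B -> isadj (A ^+ k) (B ^+ k).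
Proof.
move=> AB; elim: k => [|k IH]; first exact: isadj1.
by rewrite exprS exprSr; apply: isadjM.
Qed.

Lemma isadj_sum (I : Type) (l : seq I) (f g : I -> bop dot) :
  (forall i, isadj (f i) (g i)) -> isadj (\sum_(i <- l) f i) (\sum_(i <- l) g i).
Proof.
move=> fg; elim/big_ind2: _ => //; first exact: isadj0.
by move=> A B C D; apply: isadjD.
Qed.

Lemma cvg_rdot (f : nat -> bop dot) A x y :
  f n @[n --> \oo] --> A -> rdot (f n x) y @[n --> \oo] --> rdot (A x) y.
Proof.
move=> fA; apply/subr_cvg0/norm_cvg0P.
apply: squeeze_cvgr (cvg_cst _) (_ : (fun n =>
  inorm dot (f n x - A x) * inorm dot y) @ \oo --> _).
  by apply: nearW => n; rewrite normr_ge0 /= -rdotBl norm_rdot.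
by rewrite -(mul0r (inorm dot y)); apply: cvgMr_tmp; exact: bop_cvg_pointwise.
Qed.

Lemma isadj_lim (f g : nat -> bop dot) A B :
  f n @[n --> \oo] --> A -> g n @[n --> \oo] --> B ->
  (forall n, isadj (f n) (g n)) -> isadj A B.
Proof.
move=> fA gB fg; apply: isadj_re => x y.
have := cvg_rdot (x := x) (y := y) fA.
rewrite (_ : (fun n => _) = (fun n => rdot (g n y) x)).
  move=> h; rewrite (rdotC x); apply: cvg_unique h _ => //.
  exact: cvg_rdot.
by apply/funext => n; rewrite (isadj_rdot _ _ (fg n)) rdotC.
Qed.

Lemma positiveP A : isadj A A -> (forall x, 0 <= rdot (A x) x) -> positive A.
Proof.
move=> AA A0 x; rewrite lecE -/(rdot _ _) A0 andbT Im_dot /=.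
suff /eqP : rdot (A x) ('i%C *: x) = - rdot (A x) ('i%C *: x).
  by rewrite -addr_eq0 -mulr2n mulrn_eq0 /= => /eqP ->.
rewrite [LHS](isadj_rdot _ _ AA) linearZ rdotC /rdot linearZl_LR linearZr_LR /=.
by case: (dot _ _) => a b /=; ring.
Qed.

Lemma positive_re A x : positive A -> 0 <= rdot (A x) x.
Proof. by move=> /(_ x); rewrite lecE => /andP[]. Qed.

Lemma positive_im A x : positive A -> rdot (A x) ('i%C *: x) = 0.
Proof. by move=> /(_ x); rewrite lecE Im_dot => /andP[/eqP]. Qed.

(** Polarization over the complex numbers: the vanishing imaginary part of the form at [x + 'i *: y]
    gives the symmetry of its real part, which suffices by [isadj_re]. *)
Lemma positive_isadj A : positive A -> isadj A A.
Proof.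
move=> A0; apply: isadj_re => x y.
have := positive_im (x + 'i%C *: y) A0.
rewrite linearD linearZ !scalerDr scalerA.
rewrite !rdotDl !rdotDr (positive_im x A0).
rewrite (_ : rdot ('i%C *: A y) (('i * 'i)%C *: y) = 0); last first.
  have := positive_im y A0; rewrite /rdot !linearZr_LR linearZl_LR /=.
  by case: (dot (A y) y) => a b /= h; ring: h.
rewrite (rdotC x); rewrite /rdot !linearZr_LR !linearZl_LR /=.
case: (dot (A x) y) => a b; case: (dot (A y) x) => c d /=.
lra.
Qed.

Lemma positive_norm2 A x : positive A ->
  inorm dot (A x) ^+ 2 <= `|A| * rdot (A x) x.
Proof.
move=> A0; have AA := positive_isadj A0.
have [/eqP A00|An0] := eqVneq `|A| 0.
  move: A00; rewrite normr_eq0 => /eqP ->.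
  by rewrite inorm0 expr0n normr0 mul0r.
have Agt : 0 < `|A| by rewrite lt_neqAle eq_sym An0 /=.
(* At this vector the form is [d - 2 n / |A| + q / |A|^2] with [d], [n], [q] as named below; since
   [q <= |A| n], the last term cancels only one of the two copies of [n / |A|]. *)
have := positive_re (x - (`|A|^-1)%:C%C *: A x) A0.
rewrite linearB linearZ rdotBl !rdotBr !rdotZl !rdotZr rdotxx.
rewrite (isadj_rdot (A x) x AA) rdotxx.
set d := rdot _ _; set n := _ ^+ 2; set q := rdot (A (A x)) (A x) => h.
have qn : q <= `|A| * n.
  rewrite (le_trans (ler_norm _)) // (le_trans (norm_rdot _ _)) //.
  by rewrite /n expr2 mulrA ler_wpM2r ?inorm_ge0 // bop_normE.
have qn' : `|A|^-1 * (`|A|^-1 * q) <= `|A|^-1 * n.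
  by rewrite ler_wpM2l ?invr_ge0 // ler_pdivrMl.
by rewrite -ler_pdivrMl //; lra.
Qed.

End Adjoints.

(** * Existence and uniqueness of positive square roots *)

Section SquareRoot.
Variables (R : realType) (V : lmodType R[i]) (dot : inner V).
Hypothesis dotC : inner_complete dot.
Implicit Types (x y z : V) (A B C D P Q S X : bop dot) (r s : R).

Fixpoint scalar_iter n : R := if n is m.+1 then (1 + scalar_iter m ^+ 2) / 2 else 0.

Lemma scalar_iter_itv n : 0 <= scalar_iter n <= 1.
Proof. by elim: n => [|n /andP[y0 y1]] /=; [lra|apply/andP; split; nra]. Qed.

Lemma scalar_iterS n : scalar_iter n <= scalar_iter n.+1.
Proof. by have := scalar_iter_itv n => /= /andP[y0 y1]; nra. Qed.

Lemma scalar_iter_cvg : cvgn scalar_iter.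
Proof.
apply: nondecreasing_is_cvgn; first by apply/nondecreasing_seqP/scalar_iterS.
by exists 1 => _ [n _ <-]; have /andP[] := scalar_iter_itv n.
Qed.

(* The iteration [Y' = (X + Y ^+ 2) / 2] for [1 - sqrt (1 - X)], dominated in
   norm by the scalar iteration at [X = 1]. *)
Fixpoint sqrt_iter X n : bop dot :=
  if n is m.+1 then (2^-1 : R) *: (X + sqrt_iter X m * sqrt_iter X m) else 0.

Lemma sqrt_iter_norm X n : `|X| <= 1 -> `|sqrt_iter X n| <= scalar_iter n.
Proof.
move=> X1; elim: n => [|n IH] /=; first by rewrite normr0.
rewrite normrZ gtr0_norm ?invr_gt0 // mulrC ler_wpM2r ?invr_ge0 //.
rewrite (le_trans (ler_normD _ _)) // lerD // expr2.
by rewrite (le_trans (bop_normM _ _)) // ler_pM.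
Qed.

Lemma sqrt_iter_comm X B n : B * X = X * B ->
  B * sqrt_iter X n = sqrt_iter X n * B.
Proof.
move=> BX; elim: n => [|n IH] /=; first by rewrite mulr0 mul0r.
by rewrite -bopZAr -bopZAl mulrDr mulrDl BX mulrA IH -!mulrA IH.
Qed.

(** Iterates commute, so [a ^+ 2 - b ^+ 2] factors as [(a - b) * (a + b)], and the scalar iteration
    obeys the same recursion with nonnegative factors. *)
Lemma sqrt_iterS_norm X n : `|X| <= 1 ->
  `|sqrt_iter X n.+1 - sqrt_iter X n| <= scalar_iter n.+1 - scalar_iter n.
Proof.
move=> X1; elim: n => [|n IH].
  rewrite /= mulr0 addr0 !subr0 normrZ gtr0_norm ?invr_gt0 //; lra.
set a := sqrt_iter X n.+1 in IH *; set b := sqrt_iter X n in IH *.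
have ab : a * b = b * a.
  by apply: sqrt_iter_comm; rewrite /a -sqrt_iter_comm.
have -> : sqrt_iter X n.+2 - a = (2^-1 : R) *: ((a - b) * (a + b)).
  rewrite [sqrt_iter _ _]/= -/a {2}/a [sqrt_iter _ _]/= -/b -scalerBr.
  congr (_ *: _); rewrite mulrDr !mulrBl opprD addrACA subrr add0r -ab.
  by rewrite addrA subrK.
have -> : scalar_iter n.+2 - scalar_iter n.+1 = 2^-1 *
    ((scalar_iter n.+1 - scalar_iter n) * (scalar_iter n.+1 + scalar_iter n)).
  by rewrite /=; field.
rewrite normrZ gtr0_norm ?invr_gt0 // ler_wpM2l ?invr_ge0 //.
rewrite (le_trans (bop_normM _ _)) // ler_pM // (le_trans (ler_normD _ _)) //.
by rewrite lerD // sqrt_iter_norm.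
Qed.

Lemma sqrt_iter_cvg X : `|X| <= 1 -> cvgn (sqrt_iter X).
Proof.
move=> X1.
have -> : sqrt_iter X = series (fun n => sqrt_iter X n.+1 - sqrt_iter X n).
  apply/funext => n; rewrite /series /= telescope_sumr //= subr0.
  by [].
apply: (bop_series_cvg dotC (r := fun n => scalar_iter n.+1 - scalar_iter n)).
  by move=> n; exact: sqrt_iterS_norm.
rewrite (_ : series _ = scalar_iter); first exact: scalar_iter_cvg.
by apply/funext => n; rewrite /series /= telescope_sumr //= subr0.
Qed.

(** For [X = 1 - Q / |Q|] the limit satisfies [2 Y = X + Y ^+ 2], that is [(1 - Y) ^+ 2 = Q / |Q|];
    positivity of [1 - Y] comes from [|Y| <= 1]. The commutation clause serves uniqueness. *)
Lemma opsqrt_exists Q : positive Q -> exists S, [/\ positive S, S * S = Q &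
  forall B, B * Q = Q * B -> B * S = S * B].
Proof.
move=> Q0; have [/eqP|Qn0] := eqVneq `|Q| 0.
  rewrite normr_eq0 => /eqP ->; exists 0; split; last by [].
    by move=> x; rewrite bop0E linear0l.
  by rewrite mulr0.
have Qgt : 0 < `|Q| by rewrite lt_neqAle eq_sym Qn0 /=.
pose q := `|Q|^-1; have q0 : 0 < q by rewrite invr_gt0.
pose X := 1 - q *: Q; have QQ := positive_isadj Q0.
(* By [positive_norm2], [|X x|^2 = |x|^2 - 2 q <Q x, x> + q^2 |Q x|^2] is at most
   [|x|^2 - q <Q x, x>]. *)
have X1 : `|X| <= 1.
  apply: bop_norm_le => // x; rewrite mul1r.
  rewrite -(@ler_pXn2r _ 2) ?nnegrE ?inorm_ge0 // -!rdotxx.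
  rewrite /X bopBE bop1E bopZE rdotBl !rdotBr !rdotZl !rdotZr [rdot _ (Q x) (Q x)]rdotxx.
  rewrite -(isadj_rdot _ _ QQ).
  have h0 := positive_re x Q0.
  have h : q * inorm dot (Q x) ^+ 2 <= rdot dot (Q x) x.
    by rewrite ler_pdivrMl // positive_norm2.
  have := ler_wpM2l (ltW q0) h; have := mulr_ge0 (ltW q0) h0; lra.
have [Y YX] : exists Y : bop dot, sqrt_iter X @ \oo --> Y.
  exact/cvg_ex/sqrt_iter_cvg.
have YE : Y = (2^-1 : R) *: (X + Y * Y).
  have : (fun n => sqrt_iter X n.+1) @ \oo --> Y by rewrite (cvg_shiftS (sqrt_iter X)).
  move=> h; apply: (cvg_unique _ h) => //=.
  apply: cvgZl_tmp; apply: cvgD; first exact: cvg_cst.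
  exact: bop_cvgM.
have YY : isadj Y Y.
  apply: (isadj_lim YX YX); elim=> [|n IH] /=; first exact: isadj0.
  apply/isadjZ/isadjD; last exact: isadjM.
  by apply: isadjB; [exact: isadj1|exact: isadjZ].
have Y1 : `|Y| <= 1.
  apply: (bop_cvg_norm_le YX); apply: nearW => n.
  by rewrite (le_trans (sqrt_iter_norm _ X1)) //; have /andP[] := scalar_iter_itv n.
pose c := Num.sqrt `|Q|.
exists (c *: (1 - Y)); split.
- apply: positiveP => [|x].
    by apply/isadjZ/isadjB => //; exact: isadj1.
  rewrite bopZE rdotZl mulr_ge0 ?sqrtr_ge0 // bopBE rdotBl subr_ge0.
  rewrite (le_trans (ler_norm _)) // (le_trans (norm_rdot _ _ _)) // rdotxx expr2.
  by rewrite ler_wpM2r ?inorm_ge0 // (le_trans (bop_normE _ _)) // ler_piMl ?inorm_ge0.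
- rewrite -bopZAl -bopZAr scalerA -expr2 sqr_sqrtr //.
  have -> : (1 - Y) * (1 - Y) = q *: Q.
    have : Y + Y = X + Y * Y.
      by rewrite -[Y in LHS]scale1r -scalerDl {1}YE scalerA mulfV ?scale1r.
    move=> YY2; have {}YY2 : Y * Y = Y + Y - X by rewrite YY2 [X + _]addrC addrK.
    rewrite mulrBl mul1r mulrBr mulr1 YY2.
    have -> : Y - (Y + Y - X) = X - Y by rewrite -addrA opprD addrA subrr add0r opprB.
    by rewrite opprB addrA subrK /X opprB addrC subrK.
  by rewrite scalerA mulfV // scale1r.
- move=> B BQ; rewrite -bopZAr -bopZAl; congr (_ *: _).
  rewrite mulrBr mulrBl mulr1 mul1r; congr (_ - _).
  have BX : B * X = X * B.
    by rewrite mulrBr mulrBl mulr1 mul1r -bopZAr -bopZAl BQ.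
  have h1 : B * sqrt_iter X n @[n --> \oo] --> B * Y.
    by apply: bop_cvgM => //; exact: cvg_cst.
  apply: (cvg_unique _ h1) => //.
  rewrite (_ : (fun n => _) = fun n => sqrt_iter X n * B).
    by apply: bop_cvgM => //; exact: cvg_cst.
  by apply/funext => n; rewrite sqrt_iter_comm.
Qed.

(** Any root [A] commutes with its square, hence with the constructed root [T]. Then
    [(A + T) * (A - T) = 0], and positivity of both summands kills each of the two forms on the
    range of [D = A - T]. *)
Lemma opsqrt_unique P S : positive P -> positive S -> P * P = S * S -> P = S.
Proof.
move=> P0 S0 PS.
have SS0 : positive (S * S).
  have SS := positive_isadj S0.
  by move=> x; rewrite bopME SS dot_ge0.
have [T [T0 TQ Tcomm]] := opsqrt_exists SS0.
suff eqT A : positive A -> A * A = S * S -> A = T.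
  by rewrite (eqT _ P0 PS) (eqT _ S0 erefl).
move=> {P P0 PS} A0 AS.
have AT : A * T = T * A by apply: Tcomm; rewrite -AS mulrA.
have AA := positive_isadj A0; have TT := positive_isadj T0.
pose D := A - T; have DD : isadj D D by exact: isadjB.
have D3 x : rdot dot (D (D x)) (D x) = 0.
  have ATD : (A + T) * D = 0.
    by rewrite mulrBr !mulrDl AS TQ AT [T * A + _]addrC subrr.
  have : rdot dot (A (D x)) (D x) + rdot dot (T (D x)) (D x) = 0.
    by rewrite -rdotDl -bopDE -bopME ATD bop0E /rdot linear0l.
  have := positive_re (D x) A0; have := positive_re (D x) T0.
  by rewrite [D (D x)]bopBE rdotBl; lra.
suff Dx0 x : D x = 0 by apply/eqP; rewrite -subr_eq0; apply/eqP/bopP.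
move: D DD D3 => {}D DD D3.
have DD0 y : D (D y) = 0.
  apply/(@inorm_eq0 _ _ dot)/eqP; rewrite -sqrf_eq0 -rdotxx; apply/eqP.
  (* The two cross terms are both equal to [|D (D y)|^2] because [D] is self-adjoint. *)
  have := D3 (y + D y); rewrite !linearD !rdotDl !rdotDr !D3.
  by rewrite (isadj_rdot (D (D y)) (D y) DD); lra.
apply/(@inorm_eq0 _ _ dot)/eqP; rewrite -sqrf_eq0 -rdotxx.
by rewrite (isadj_rdot _ _ DD) DD0 /rdot linear0r.
Qed.

Lemma opabsP A B : isadj A B ->
  [/\ positive (opabs A), opabs A * opabs A = B * A &
    forall S, positive S -> S * S = B * A -> opabs A = S].
Proof.
move=> AB.
have BA0 : positive (B * A) by move=> x; rewrite bopME (isadj_sym AB) dot_ge0.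
have [T [T0 TQ _]] := opsqrt_exists BA0.
rewrite /opabs (adjE AB); case: xgetP => [C _ [C0 CC]|/(_ T)]; last by case.
by split=> // S S0 SS; apply: opsqrt_unique => //; rewrite SS.
Qed.

End SquareRoot.

(** * Piecewise C1 curves: length and concatenation *)

Section Curves.
Variables (R : realType) (W : normedModType R).
Implicit Types (c d : R -> W) (a b m t : R).

Lemma C1_on_ext c d a b : {in `[a, b], c =1 d} -> C1_on c a b -> C1_on d a b.
Proof.
move=> cd [cc [g gc cg]]; split.
  by apply: subspace_eq_continuous cc => t; rewrite inE => /cd.
exists g => // t tab; apply: near_eq_is_derive (cg t tab).
near=> s; apply: cd; apply: subset_itv_oo_cc; near: s.
exact: near_in_itvoo.
Unshelve. all: by end_near. Qed.

Lemma C1_on_derivative c (g : R -> W) a b :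
  (forall t, is_derive t 1 c (g t)) -> continuous g -> C1_on c a b.
Proof.
move=> cg gc; split.
  apply: derivable_within_continuous => t _; exact: ex_derive.
by exists g => //; exact: continuous_subspaceT.
Qed.

Lemma C1_on_measurable c a b : a < b -> C1_on c a b ->
  measurable_fun `[a, b] (fun t => `|derive1 c t|).
Proof.
move=> ab [_ [g gc cg]].
apply: (@measurable_fun_itv_cc R a b false true).
apply: (@eq_measurable_fun _ _ _ _ _ (fun t => `|g t|)).
  by move=> t; rewrite inE => /cg ?; rewrite derive1E derive_val.
apply: open_continuous_measurable_fun; first exact: interval_open.
move=> t; rewrite inE /= => tab; apply: cvg_norm.
exact: within_continuous_continuous ab gc tab.
Qed.

Lemma piecewise_C1_measurable c a b : piecewise_C1 c a b ->
  measurable_fun `[a, b] (fun t => `|derive1 c t|).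
Proof.
case=> s; elim: s a => [|x s IH] a ps cs.
  have -> : [set` `[a, b]] = [set a] by rewrite (itv_partition_nil ps) set_itv1.
  exact: measurable_fun_set1.
have ps' := itv_partition_cons ps.
have ax : a < x by case: ps => /= /andP[].
have xb := itv_partition_le ps'.
have -> : [set` `[a, b]] = `[a, x] `|` `[x, b].
  apply/seteqP; split => t /=; rewrite !in_itv /=.
    by move=> /andP[at_ tb]; have [tx|/ltW xt] := leP t x; [left|right];
      rewrite ?at_ ?xt.
  move=> [/andP[-> tx]|/andP[xt ->]]; first exact: le_trans xb.
  by rewrite (le_trans (ltW ax)).
apply/measurable_funU => //; split.
  by apply: C1_on_measurable => //; exact: (cs 0%N).
by apply: IH => // k ks; exact: (cs k.+1).
Qed.

(** At the end points [derive1] is a two-sided derivative and sees the curve outside the interval;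
    these two points are negligible for the integral. *)
Lemma length_eq_derive1 c d a b :
  measurable_fun `]a, b[ (fun t => `|derive1 d t|) ->
  {in `]a, b[, derive1 c =1 derive1 d} -> length c a b = length d a b.
Proof.
move=> md cd; apply: eq_integral_itv_bounded => //.
  by apply: (eq_measurable_fun _ _ md) => t; rewrite inE => /cd ->.
by move=> t /cd ->.
Qed.

Lemma length_cst c (g : R -> W) (l : R) a b : a <= b ->
  (forall t, t \in `]a, b[ -> is_derive t 1 c (g t)) ->
  (forall t, t \in `]a, b[ -> `|g t| = l) -> length c a b = ((b - a) * l)%:E.
Proof.
move=> ab cg gl; transitivity (\int[lebesgue_measure]_(t in `[a, b]) (l%:E))%E.
  apply: (@eq_integral_itv_bounded R a b (fun=> l) (fun t => `|derive1 c t|)).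
  - apply: (eq_measurable_fun (fun=> l)); last exact: measurable_cst.
    by move=> t; rewrite inE => tab; have ? := cg t tab;
      rewrite derive1E derive_val gl.
  - exact: measurable_cst.
  - by move=> t tab; have ? := cg t tab; rewrite derive1E derive_val gl.
rewrite integral_cst //= lebesgue_measure_itv /= lte_fin mulrC.
move: ab; rewrite le_eqVlt => /predU1P[->|ab].
  by rewrite ltxx subrr mulr0 mule0.
by rewrite ab -EFinB -EFinM.
Qed.

Definition concat c d m t := if t < m then c t else d t.

Lemma concat_derive1l c d m t : t < m -> derive1 (concat c d m) t = derive1 c t.
Proof.
move=> tm; rewrite !derive1E; apply: near_eq_derive; near=> s.
rewrite /concat ifT //; near: s; exact: lt_nbhsl.
Unshelve. all: by end_near. Qed.

Lemma concat_derive1r c d m t : m < t -> derive1 (concat c d m) t = derive1 d t.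
Proof.
move=> tm; rewrite !derive1E; apply: near_eq_derive; near=> s.
rewrite /concat ifF //; apply/negbTE; rewrite -leNgt; apply/ltW; near: s.
exact: lt_nbhsr.
Unshelve. all: by end_near. Qed.

(** The first curve is a single C1 piece because the arc put in front will always be an orbit. *)
Lemma piecewise_C1_concat c d a m b : a < m -> C1_on c a m ->
  piecewise_C1 d m b -> c m = d m -> piecewise_C1 (concat c d m) a b.
Proof.
move=> am cc [s ps ds] cdm; exists (m :: s).
  have := itv_partition_cat (itv_partition1 am) ps; exact.
case=> [_|k] /=.
  apply: C1_on_ext cc => t; rewrite in_itv /= => /andP[_].
  by rewrite /concat le_eqVlt => /predU1P[->|->//]; rewrite ltxx.
rewrite ltnS => ks; apply: C1_on_ext (ds k ks) => t.
rewrite in_itv /= => /andP[+ _] => mt; rewrite /concat ifF //.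
apply/negbTE; rewrite -leNgt (le_trans _ mt) //.
by apply: itv_partition_nth_ge ps; rewrite ltnS ltnW.
Qed.

Lemma length_concat c d a m b : a < m -> m <= b -> C1_on c a m ->
  piecewise_C1 d m b -> c m = d m ->
  length (concat c d m) a b = (length c a m + length d m b)%E.
Proof.
move=> am mb cc dd cdm; set e := concat c d m.
have me := piecewise_C1_measurable (piecewise_C1_concat am cc dd cdm).
rewrite -/e in me.
have lc : length c a m = length e a m.
  apply: length_eq_derive1 => [|t].
    apply: measurable_funS me => //; apply: subset_itv; rewrite bnd_simp //.
  by rewrite in_itv /= => /andP[_ tm]; rewrite concat_derive1l.
have ld : length d m b = length e m b.
  apply: length_eq_derive1 => [|t].
    apply: measurable_funS me => //; apply: subset_itv; rewrite bnd_simp //.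
    exact: ltW.
  by rewrite in_itv /= => /andP[mt _]; rewrite concat_derive1r.
rewrite lc ld /length.
(* Dropping the point [m] from the first interval makes the union disjoint. *)
rewrite -(@integral_itv_bndo_bndc R (BLeft a) m); last first.
  apply/measurable_EFinP; apply: measurable_funS me => //.
  by apply: subset_itv; rewrite bnd_simp.
have E : [set` `[a, b]] = `[a, m[ `|` `[m, b].
  apply/seteqP; split => t /=; rewrite !in_itv /=.
    by move=> /andP[at_ tb]; have [tx|xt] := ltP t m; [left|right];
      rewrite ?at_ ?xt.
  move=> [/andP[-> tx]|/andP[xt ->]]; first by rewrite (le_trans (ltW tx)).
  by rewrite (le_trans (ltW am)).
rewrite E ge0_integral_setU //; last 2 first.
- by apply/measurable_EFinP; rewrite -E.
- apply/disj_setPS => t /= []; rewrite !in_itv /= => /andP[_ tm] /andP[mt _].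
  by move: tm; rewrite ltNge mt.
Qed.

End Curves.

(** * Derivatives as limits of difference quotients *)

Section DifferenceQuotients.
Variables (R : realType) (W : normedModType R).
Implicit Types (f : R -> W) (t : R).

Lemma is_deriveP f t (D : W) : is_derive t 1 f D <->
  (h^-1 *: (f (h + t) - f t) @[h --> 0^'] --> D).
Proof.
have E : (fun h : R => h^-1 *: ((f \o shift t) (h *: (1 : R)) - f t)) =
    (fun h => h^-1 *: (f (h + t) - f t)).
  by apply/funext => h /=; rewrite /GRing.scale /= mulr1.
split=> [[dv <-]|fD]; first by move: dv; rewrite /derivable /derive E.
by apply: DeriveDef; rewrite /derivable /derive E; [apply/cvg_ex; exists D|apply/cvg_lim].
Qed.

Lemma quadratic_cvg f (D w : W) (K : R) :
  (forall h, `|h| <= 1 -> `|f h - w - h *: D| <= h ^+ 2 * K) ->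
  h^-1 *: (f h - w) @[h --> 0^'] --> D.
Proof.
move=> fK; apply/subr_cvg0/norm_cvg0P.
have lim0 : `|h| * K @[h --> (0 : R)^'] --> (0 : R).
  have id0 : h @[h --> (0 : R)^'] --> (0 : R) by exact: nbhs_dnbhs.
  have n0 : `|h| @[h --> (0 : R)^'] --> (0 : R).
    by have := cvg_norm id0; rewrite normr0; apply.
  by rewrite -[X in _ --> X](mul0r K); apply: cvgMr_tmp.
apply: squeeze_cvgr (cvg_cst _) lim0; near=> h.
have h0 : h != 0 by near: h; exact: nbhs_dnbhs_neq.
have h1 : `|h| <= 1.
  by near: h; apply: filterS (dnbhs0_lt ltr01) => h /ltW.
rewrite normr_ge0 /=.
have -> : h^-1 *: (f h - w) - D = h^-1 *: (f h - w - h *: D).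
  by rewrite [RHS]scalerBr scalerA mulVf // scale1r.
rewrite normrZ normfV ler_pdivrMl ?normr_gt0 // mulrA -normrM -expr2.
by rewrite ger0_norm ?sqr_ge0 // fK.
Unshelve. all: by end_near. Qed.

End DifferenceQuotients.

(** * One-parameter unitary groups and their orbits of projections *)

Section UnitaryGroups.
Variables (R : realType) (V : lmodType R[i]) (dot : inner V).
Implicit Types (p q A B J : bop dot) (s t h : R) (U : R -> bop dot).

(** Covers both groups in use: the exponentials generating a geodesic and the rotations
    [cos t + sin t * J] with [J * J = - 1]. *)
Definition unitary_group U J : Prop :=
  [/\ forall s t, U (s + t) = U s * U t, U 0 = 1,
      forall t, isadj (U t) (U (- t)) &
      h^-1 *: (U h - 1) @[h --> 0^'] --> J].

Definition orbit U p t := U t * p * U (- t).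

Lemma isadj_isometry A B x : isadj A B -> B * A = 1 ->
  inorm dot (A x) = inorm dot x.
Proof.
move=> AB BA; apply/eqP; rewrite -(@eqrXn2 _ 2) ?inorm_ge0 // -!rdotxx.
by rewrite (isadj_rdot _ _ AB) -bopME BA bop1E.
Qed.

Lemma isadj_isometry_norm A B : isadj A B -> B * A = 1 -> `|A| <= 1.
Proof.
by move=> AB BA; apply: bop_norm_le => // x; rewrite (isadj_isometry _ AB BA) mul1r.
Qed.

Lemma unitary_isadj A B : isadj A B -> A * B = 1 -> B * A = 1 -> unitary A.
Proof. by move=> AB A1 B1; rewrite /unitary (adjE AB). Qed.

Section Orbits.
Variables (U : R -> bop dot) (J : bop dot).
Hypothesis UJ : unitary_group U J.

Lemma groupN t : U t * U (- t) = 1.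
Proof. by case: UJ => UD U0 _ _; rewrite -UD subrr. Qed.

Lemma groupVN t : U (- t) * U t = 1.
Proof. by have := groupN (- t); rewrite opprK. Qed.

Lemma group_isometry t x : inorm dot (U t x) = inorm dot x.
Proof. by case: UJ => _ _ UV _; apply: isadj_isometry (UV t) (groupVN t). Qed.

Lemma group_norm t : `|U t| <= 1.
Proof. by case: UJ => _ _ UV _; apply: isadj_isometry_norm (UV t) (groupVN t). Qed.

Lemma group_unitary t : unitary (U t).
Proof.
by case: UJ => _ _ UV _; apply: unitary_isadj (UV t) (groupN t) (groupVN t).
Qed.

Lemma group_adj t : adj (U t) = U (- t).
Proof. by case: UJ => _ _ UV _; apply: adjE. Qed.

Lemma group_is_derive t : is_derive t 1 U (U t * J).
Proof.
case: UJ => UD U0 _ UJ0; apply/is_deriveP.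
rewrite (_ : (fun h => _) = (fun h => U t * (h^-1 *: (U h - 1)))).
  by apply: bop_cvgM => //; exact: cvg_cst.
by apply/funext => h; rewrite -bopZAr mulrBr mulr1 -UD [h + t]addrC.
Qed.

Lemma group_continuous : continuous U.
Proof.
move=> t; apply/differentiable_continuous/derivable1_diffP.
by case: (group_is_derive t).
Qed.

Lemma groupN_continuous : continuous (fun t => U (- t)).
Proof.
by move=> t; apply: continuous_comp; [exact: oppr_continuous|exact: group_continuous].
Qed.

Lemma orbit_continuous p : continuous (orbit U p).
Proof.
move=> t; apply: bop_cvgM; last exact: groupN_continuous.
by apply: bop_cvgM; [exact: group_continuous|exact: cvg_cst].
Qed.

Lemma orbit_quotient0 p :
  h^-1 *: (U h * p * U (- h) - p) @[h --> 0^'] --> J * p - p * J.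
Proof.
case: UJ => UD U0 _ UJ0.
(* Since [U (- h) * (U h - 1) = 1 - U (- h)], both halves of the quotient involve only the quotient
   of [U] at [h]. *)
rewrite (_ : (fun h => _) = (fun h => h^-1 *: (U h - 1) * p * U (- h) -
    p * (U (- h) * (h^-1 *: (U h - 1))))); last first.
  apply/funext => h; rewrite -!bopZAl -!bopZAr -scalerBr; congr (_ *: _).
  rewrite mulrBr mulr1 groupVN mulrBr mulr1 !mulrBl mul1r.
  by rewrite opprB addrA subrK.
have UN : U (- h) @[h --> (0 : R)^'] --> (1 : bop dot).
  apply: cvg_within_filter; rewrite -U0 -[X in _ --> U X]oppr0.
  exact: groupN_continuous.
rewrite -[X in _ --> X - _]mulr1 -[X in _ --> _ - p * X]mul1r.
apply: cvgB; apply: bop_cvgM => //.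
- by apply: bop_cvgM => //; exact: cvg_cst.
- exact: cvg_cst.
- exact: bop_cvgM.
Qed.

Lemma orbit_is_derive p t :
  is_derive t 1 (orbit U p) (orbit U (J * p - p * J) t).
Proof.
case: UJ => UD U0 _ _; apply/is_deriveP.
rewrite (_ : (fun h => _) = (fun h => U t *
    (h^-1 *: (U h * p * U (- h) - p)) * U (- t))).
  apply: bop_cvgM; last exact: cvg_cst.
  by apply: bop_cvgM; [exact: cvg_cst|exact: orbit_quotient0].
apply/funext => h; rewrite -bopZAr -bopZAl; congr (_ *: _).
by rewrite /orbit mulrBr mulrBl [h + t]addrC opprD [- t - h]addrC !UD !mulrA.
Qed.

Lemma orbit_norm p t : `|orbit U p t| = `|p|.
Proof.
have le q s : `|orbit U q s| <= `|q|.
  apply: le_trans (bop_normM _ _) _; rewrite -[leRHS]mulr1.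
  apply: ler_pM => //; last exact: group_norm.
  by apply: le_trans (bop_normM _ _) _; rewrite ler_piMl ?group_norm.
apply/le_anti; rewrite le /=; have := le (orbit U p t) (- t).
by rewrite /orbit opprK !mulrA groupVN mul1r -mulrA groupVN mulr1.
Qed.

Lemma orbit_C1 p a b : C1_on (orbit U p) a b.
Proof.
apply: C1_on_derivative (orbit_is_derive p) _; exact: orbit_continuous.
Qed.

Lemma orbit_length c p a b : a <= b ->
  (forall t, t \in `]a, b[ -> c t = orbit U p t) ->
  length c a b = ((b - a) * `|J * p - p * J|)%:E.
Proof.
move=> ab cU; apply: (length_cst (g := orbit U (J * p - p * J))) => // t tab.
  apply: near_eq_is_derive (orbit_is_derive p t); near=> s.
  by rewrite cU //; near: s; exact: near_in_itvoo.
by rewrite orbit_norm.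
Unshelve. all: by end_near. Qed.

End Orbits.

Lemma rotation_group J : isadj J (- J) -> J * J = - 1 ->
  unitary_group (fun t => cos t *: (1 : bop dot) + sin t *: J) J.
Proof.
move=> JN JJ; split=> [s t||t|].
- rewrite cosD sinD mulrDl !mulrDr -!bopZAl -!bopZAr !scalerA JJ !mul1r mulr1.
  rewrite scalerN scalerBl scalerDl [sin s * cos t]mulrC.
  by rewrite addrACA [RHS]addrACA; congr (_ + _); rewrite addrC.
- by rewrite cos0 sin0 scale1r scale0r addr0.
- rewrite cosN sinN; apply: isadjD; first exact/isadjZ/isadj1.
  by rewrite scaleNr -scalerN; apply: isadjZ.
- have C : h^-1 *: (cos h - 1) @[h --> (0 : R)^'] --> (0 : R).
    have /is_deriveP := is_derive_cos (0 : R); rewrite sin0 oppr0 cos0.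
    by under eq_fun do rewrite addr0.
  have S : h^-1 *: sin h @[h --> (0 : R)^'] --> (1 : R).
    have /is_deriveP := is_derive_sin (0 : R); rewrite sin0 cos0.
    by under eq_fun do rewrite addr0 subr0.
  rewrite (_ : (fun h => _) = (fun h => (h^-1 *: (cos h - 1)) *: (1 : bop dot) +
      (h^-1 *: sin h) *: J)).
    rewrite -[X in _ --> X]add0r -[X in _ --> X + _](scale0r (1 : bop dot)).
    rewrite -[X in _ --> _ + X]scale1r.
    by apply: cvgD; apply: cvgZr_tmp.
  apply/funext => h; rewrite -!scalerA -scalerDr; congr (_ *: _).
  by rewrite scalerBl scale1r addrAC.
Qed.

End UnitaryGroups.

Section ExponentialGroup.
Variables (R : realType) (V : lmodType R[i]) (dot : inner V).
Hypothesis dotC : inner_complete dot.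

Lemma opexp_group (Y : bop dot) : isadj Y (- Y) ->
  unitary_group (fun t => opexp (t *: Y)) Y.
Proof.
move=> YN; split=> [s t||t|].
- exact: opexpD.
- by rewrite scale0r opexp0.
- apply: (isadj_lim (@opexp_cvg _ _ _ dotC (t *: Y))
    (@opexp_cvg _ _ _ dotC (- t *: Y))) => n.
  apply: isadj_sum => k; apply/isadjZ/isadjX.
  by rewrite scaleNr -scalerN; apply: isadjZ.
- apply: quadratic_cvg => h; exact: opexp_quadratic.
Qed.

End ExponentialGroup.

(** * Inverses: continuity, Neumann series, coercive operators *)

Section Inverses.
Variables (R : realType) (V : lmodType R[i]) (dot : inner V).
Implicit Types (A B C G X : bop dot) (c q : R).

Lemma opinvE A B : is_inverse A B -> opinv A = B.
Proof.
move=> [AB BA]; rewrite /opinv; case: xgetP => [C _ [AC CA]|/(_ B) []//].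
by rewrite -[C]mulr1 -AB mulrA CA mul1r.
Qed.

Lemma opinvP A : invertible A -> is_inverse A (opinv A).
Proof. by case=> B AB; rewrite (opinvE AB). Qed.

Lemma cvg_opinv (T : Type) (F : set_system T) {FF : Filter F}
    (f : T -> bop dot) A :
  f @ F --> A -> invertible A -> (\forall t \near F, invertible (f t)) ->
  opinv (f t) @[t --> F] --> opinv A.
Proof.
move=> fA /opinvP; set B := opinv A => -[AB BA] finv.
have lim0 : (`|B| * 2) * `|f t - A| * `|B| @[t --> F] --> (0 : R).
  have -> : 0 = `|B| * 2 * 0 * `|B| by rewrite mulr0 mul0r.
  apply: cvgMr_tmp; apply: cvgMl_tmp.
  exact/norm_cvg0P/subr_cvg0.
apply/subr_cvg0/norm_cvg0P; apply: squeeze_cvgr (cvg_cst _) lim0.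
(* Within this distance [|f t - A| * |B| <= 1 / 2], so [|G| <= |G| / 2 + |B|] and the inverses stay
   bounded by [2 * |B|]. *)
have d0 : 0 < (2 * (1 + `|B|))^-1 by rewrite invr_gt0 mulr_gt0 // ltr_pwDl.
near=> t.
have [fG Gf] : is_inverse (f t) (opinv (f t)) by apply: opinvP; near: t.
have fAt : `|f t - A| <= (2 * (1 + `|B|))^-1.
  by near: t; move/cvgrPdistC_le : fA; apply.
set G := opinv (f t) in fG Gf *; rewrite normr_ge0 /=.
have GB : G - B = - (G * (f t - A) * B).
  by rewrite mulrBr Gf mulrBl mul1r -mulrA AB mulr1 opprB.
have nGB : `|G - B| <= `|G| * `|f t - A| * `|B|.
  rewrite GB normrN (le_trans (bop_normM _ _)) // ler_wpM2r //.
  exact: bop_normM.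
have G2 : `|G| <= `|B| * 2.
  have h1 : `|G| <= `|G - B| + `|B| by rewrite -{1}[G](subrK B) ler_normD.
  have h2 : `|G| * `|f t - A| * `|B| <= `|G| / 2.
    rewrite -mulrA ler_wpM2l // (le_trans (ler_wpM2r _ fAt)) //.
    rewrite ler_pdivrMl ?mulr_gt0 ?ltr_pwDl //.
    by rewrite mulrAC mulfV // mul1r lerDr.
  lra.
apply: le_trans nGB _; rewrite ler_wpM2r // ler_wpM2r //.
Unshelve. all: by end_near. Qed.

Hypothesis dotC : inner_complete dot.

Lemma neumann A q : `|1 - A| <= q -> q < 1 -> invertible A.
Proof.
move=> Aq q1; set X := 1 - A in Aq.
have q0 : 0 <= q by exact: le_trans Aq.
have Xq k : `|X ^+ k| <= q ^+ k.
  by rewrite (le_trans (bop_normX _ _)) // lerXn2r ?nnegrE.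
have [B XB] : exists B : bop dot, series (fun k => X ^+ k) @ \oo --> B.
  apply/cvg_ex/(bop_series_cvg dotC (r := fun k => q ^+ k)) => //.
  rewrite (_ : (fun k => q ^+ k) = geometric 1 q).
    by apply: is_cvg_geometric_series; rewrite ger0_norm.
  by apply/funext => k; rewrite /geometric /= mul1r.
have X0 : X ^+ n @[n --> \oo] --> (0 : bop dot).
  apply/norm_cvg0P; apply: squeeze_cvgr (cvg_cst _) (cvg_expr _) => //.
    by apply: nearW => n; rewrite normr_ge0 /=; exact: Xq.
  by rewrite ger0_norm.
have XA : A = 1 - X by rewrite /X opprB addrC subrK.
have lim1 : 1 - X ^+ n @[n --> \oo] --> (1 : bop dot).
  by rewrite -[X in _ --> X]subr0; apply: cvgB => //; exact: cvg_cst.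
exists B; split.
- have h : A * series (fun k => X ^+ k) n @[n --> \oo] --> A * B.
    by apply: bop_cvgM => //; exact: cvg_cst.
  apply: (cvg_unique _ h) => //; rewrite (_ : (fun n => _) = (fun n => 1 - X ^+ n)) //.
  apply/funext => n; rewrite XA; elim: n => [|n IH].
    by rewrite /series /= big_nil mulr0 expr0 subrr.
  by rewrite seriesSr mulrDr IH mulrBl mul1r -exprS addrA subrK.
- have h : series (fun k => X ^+ k) n * A @[n --> \oo] --> B * A.
    by apply: bop_cvgM => //; exact: cvg_cst.
  apply: (cvg_unique _ h) => //; rewrite (_ : (fun n => _) = (fun n => 1 - X ^+ n)) //.
  apply/funext => n; rewrite XA; elim: n => [|n IH].
    by rewrite /series /= big_nil mul0r expr0 subrr.
  by rewrite seriesSr mulrDl IH mulrBr mulr1 -exprSr addrA subrK.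
Qed.

(** Expanding the square gives [|x - c C x|^2 <= (1 - 2 c^2 + c^2) |x|^2], so [1 - c *: C] is a
    strict contraction and [c *: C] has a Neumann inverse. *)
Lemma coercive_invertible C c : 0 < c <= 1 -> `|C| <= 1 ->
  (forall x, c * inorm dot x ^+ 2 <= rdot dot (C x) x) -> invertible C.
Proof.
move=> /andP[c0 c1] C1 Cc.
have /neumann : `|1 - c *: C| <= Num.sqrt (1 - c ^+ 2).
  have c21 : 0 <= 1 - c ^+ 2 by rewrite subr_ge0 expr_le1 // ltW.
  apply: bop_norm_le => [|x]; first exact: sqrtr_ge0.
  rewrite -(@ler_pXn2r _ 2) ?nnegrE ?mulr_ge0 ?inorm_ge0 ?sqrtr_ge0 //.
  rewrite exprMn (sqr_sqrtr c21) -!rdotxx bopBE bop1E bopZE.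
  rewrite rdotBl !rdotBr !rdotZl !rdotZr (rdotC _ x) [rdot _ (C x) (C x)]rdotxx.
  have := Cc x; rewrite rdotxx => h.
  have h1 : inorm dot (C x) ^+ 2 <= inorm dot x ^+ 2.
    rewrite ler_pXn2r ?nnegrE ?inorm_ge0 //.
    by rewrite (le_trans (bop_normE _ _)) // ler_piMl ?inorm_ge0.
  have := ler_wpM2l (ltW c0) h.
  have := ler_wpM2l (sqr_ge0 c) h1.
  rewrite !expr2; lra.
case.
  by rewrite -[ltRHS]sqrtr1 ltr_sqrt // ltrBlDr ltrDl exprn_gt0.
move=> B [CB BC]; exists (c *: B); split.
  by rewrite -bopZAr bopZAl.
by rewrite -bopZAl bopZAr.
Qed.

End Inverses.

(** * Block operators and the first column of the exponential *)

Section Blocks.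
Variables (R : realType) (V : lmodType R[i]) (dot : inner V).
Implicit Types (a b A B C D S Q : bop dot).

Lemma blockM A B C D A' B' C' D' : block A B C D * block A' B' C' D' =
  block (A * A' + B * C') (A * B' + B * D') (C * A' + D * C') (C * B' + D * D').
Proof.
apply: bopP => x; rewrite bopME /=; congr (_, _); rewrite !linearD;
  by rewrite addrACA.
Qed.

Lemma blockD A B C D A' B' C' D' : block A B C D + block A' B' C' D' =
  block (A + A') (B + B') (C + C') (D + D').
Proof. by apply: bopP => x; rewrite bopDE /=; congr (_, _); rewrite addrACA. Qed.

Lemma blockZ (r : R) A B C D :
  r *: block A B C D = block (r *: A) (r *: B) (r *: C) (r *: D).
Proof. by apply: bopP => x; rewrite bopZE /=; congr (_, _); rewrite scalerDr. Qed.

Lemma block0 : block (dot := dot) 0 0 0 0 = 0.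
Proof. by apply: bopP => x; rewrite /= ?bop0E addr0. Qed.

Lemma block_isadj A B C D A' B' C' D' :
  isadj A A' -> isadj B B' -> isadj C C' -> isadj D D' ->
  isadj (block A B C D) (block A' C' B' D').
Proof.
move=> AA BB CC DD [x1 x2] [y1 y2]; rewrite /= /sum_inner /=.
by rewrite !linearDl !linearDr /= AA BB CC DD addrACA.
Qed.

Lemma block_col_norm A C : `|block A 0 C 0| <= `|A| + `|C|.
Proof.
apply: bop_norm_le => [|x]; first exact: addr_ge0.
rewrite (le_trans (inorm_sum_le _ _)) //= ?bop0E !addr0 mulrDl lerD //.
  by rewrite (le_trans (bop_normE _ _)) // ler_wpM2l ?inorm_fst_le.
by rewrite (le_trans (bop_normE _ _)) // ler_wpM2l ?inorm_fst_le.
Qed.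

Lemma block_col_norml A C : `|A| <= `|block A 0 C 0|.
Proof.
apply: bop_norm_le => // x.
have := bop_normE (block A 0 C 0) (x, 0); rewrite /= ?bop0E !addr0.
rewrite (_ : inorm (sum_inner dot) (x, 0) = inorm dot x).
  exact/le_trans/(@inorm_fst_le _ _ _ (A x, C x)).
apply/eqP; rewrite -(@eqrXn2 _ 2) ?inorm_ge0 // inorm_sum /= inorm0.
by rewrite expr0n addr0.
Qed.

Lemma block_col_normr A C : `|C| <= `|block A 0 C 0|.
Proof.
apply: bop_norm_le => // x.
have := bop_normE (block A 0 C 0) (x, 0); rewrite /= ?bop0E !addr0.
rewrite (_ : inorm (sum_inner dot) (x, 0) = inorm dot x).
  exact/le_trans/(@inorm_snd_le _ _ _ (A x, C x)).
apply/eqP; rewrite -(@eqrXn2 _ 2) ?inorm_ge0 // inorm_sum /= inorm0.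
by rewrite expr0n addr0.
Qed.

Lemma block_colB A C A' C' :
  block A 0 C 0 - block A' 0 C' 0 = block (A - A') 0 (C - C') 0.
Proof. by rewrite -scaleN1r blockZ blockD !scaleN1r !subr0. Qed.

Lemma cvg_block_col (T : Type) (F : set_system T) {FF : Filter F}
    (f g : T -> bop dot) A C :
  (block (f t) 0 (g t) 0 @[t --> F] --> block A 0 C 0) <->
  (f @ F --> A /\ g @ F --> C).
Proof.
split=> [/subr_cvg0/norm_cvg0P fgAC|[/subr_cvg0/norm_cvg0P fA /subr_cvg0/norm_cvg0P gC]].
  split; apply/subr_cvg0/norm_cvg0P; apply: squeeze_cvgr (cvg_cst _) fgAC;
    apply: nearW => t; rewrite normr_ge0 /= block_colB.
    exact: block_col_norml.
  exact: block_col_normr.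
apply/subr_cvg0/norm_cvg0P; apply: squeeze_cvgr (cvg_cst _)
  (_ : (fun t => `|f t - A| + `|g t - C|) @ F --> _).
  by apply: nearW => t; rewrite normr_ge0 /= block_colB block_col_norm.
by rewrite -[X in _ --> X]addr0; apply: cvgD.
Qed.

Hypothesis dotC : inner_complete dot.

Lemma leq_fact_double k : (k`! <= k.*2`!)%N.
Proof. by apply: leq_fact; rewrite -addnn leq_addr. Qed.

Lemma opcos_cvg S :
  series (fun k : nat => ((-1) ^+ k / (k.*2)`!%:R : R) *: S ^+ k.*2) @ \oo -->
  opcos S.
Proof.
apply: (bop_series_cvg dotC (r := exp_coeff (`|S| ^+ 2))) => [k|].
  rewrite normrZ normrM normrX normrN1 expr1n mul1r ger0_norm //.
  rewrite /exp_coeff /= -exprM mul2n [leRHS]mulrC ler_pM //.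
    by rewrite lef_pV2 ?posrE ?ltr0n ?fact_gt0 // ler_nat leq_fact_double.
  exact: bop_normX.
exact: is_cvg_series_exp_coeff.
Qed.

Lemma opsinc_cvg S :
  series (fun k : nat => ((-1) ^+ k / (k.*2.+1)`!%:R : R) *: S ^+ k.*2) @ \oo -->
  opsinc S.
Proof.
apply: (bop_series_cvg dotC (r := exp_coeff (`|S| ^+ 2))) => [k|].
  rewrite normrZ normrM normrX normrN1 expr1n mul1r ger0_norm //.
  rewrite /exp_coeff /= -exprM mul2n [leRHS]mulrC ler_pM //.
    rewrite lef_pV2 ?posrE ?ltr0n ?fact_gt0 // ler_nat.
    by rewrite (leq_trans (leq_fact_double k)) // leq_fact.
  exact: bop_normX.
exact: is_cvg_series_exp_coeff.
Qed.

Lemma cvgn_double : n.*2 @[n --> \oo] --> \oo.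
Proof.
move=> A [N _ NA]; exists N => // n Nn; apply: NA => /=.
by rewrite (leq_trans Nn) // -addnn leq_addr.
Qed.

(** On the first summand [Y ^+ 2] acts as [- S ^+ 2]: even powers sum to the cosine, and one more
    factor [Y] moves the odd ones to the second row, with [b] in front and only even powers of
    [S]. *)
Lemma opexp_col a b S : S * S = a * b ->
  opexp (block 0 (- a) b 0) * base_proj dot =
  block (opcos S) 0 (b * opsinc S) 0.
Proof.
move=> SS; set Y := block _ _ _ _; set p := base_proj dot.
have Y2 A C : Y * (Y * block A 0 C 0) = block (- (S * S * A)) 0 (- (b * (a * C))) 0.
  rewrite !blockM !(mul0r, mulr0, addr0, add0r) SS.
  by rewrite !mulNr mulrN !mulrA.
have Yeven k : Y ^+ k.*2 * p = block ((-1) ^+ k *: S ^+ k.*2) 0 0 0.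
  elim: k => [|k IH]; first by rewrite expr0 mul1r scale1r.
  rewrite doubleS !exprS -!mulrA IH Y2 !mulr0 oppr0.
  by congr block; rewrite mulN1r scaleNr -bopZAr mulrA.
have Yodd k : Y ^+ k.*2.+1 * p = block 0 0 ((-1) ^+ k *: (b * S ^+ k.*2)) 0.
  by rewrite exprS -mulrA Yeven blockM !(mul0r, mulr0, addr0, add0r) bopZAr.
(* Partial sums of even length contain equally many even and odd powers, hence match those of
   [opcos] and [opsinc] at the same [n]. *)
have lim1 : series (fun k => (k`!%:R^-1 : R) *: Y ^+ k) n.*2 * p @[n --> \oo] -->
    opexp Y * p.
  apply: bop_cvgM; last exact: cvg_cst.
  by apply: cvg_comp cvgn_double _; apply: opexp_cvg; exact: sum_inner_complete.
apply: (cvg_unique _ lim1) => //.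
rewrite (_ : (fun n => _) = (fun n => block
  (series (fun k : nat => ((-1) ^+ k / (k.*2)`!%:R : R) *: S ^+ k.*2) n) 0
  (b * series (fun k : nat => ((-1) ^+ k / (k.*2.+1)`!%:R : R) *: S ^+ k.*2) n) 0)).
  apply/cvg_block_col; split; first exact: opcos_cvg.
  by apply: bop_cvgM; [exact: cvg_cst|exact: opsinc_cvg].
apply/funext; elim=> [|n IH].
  by rewrite /series /= !big_nil mul0r mulr0 block0.
rewrite doubleS !seriesSr !mulrDl IH -!bopZAl Yeven Yodd !blockZ !scaler0.
rewrite !blockD !addr0 mulrDr; congr block.
  by rewrite scalerA mulrC.
by rewrite -bopZAr scalerA mulrC.
Qed.

End Blocks.

(** * Orthogonal projections *)

Section Projections.
Variables (R : realType) (V : lmodType R[i]) (dot : inner V).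
Implicit Types (P Q : bop dot).

(** Two projections with the same range satisfy [Q * P = P] and [P * Q = Q]; taking adjoints
    identifies them. *)
Lemma orthoprojE P (E : set V) :
  P * P = P -> isadj P P -> range P = E -> orthoproj dot E = P.
Proof.
move=> PP Pa PE; rewrite /orthoproj; case: xgetP => [Q _ [QQ Qa QE]|/(_ P)].
  have {}Qa := selfadjP Qa.
  have QP : Q * P = P.
    apply: bopP => x; have [y _ yx] : range Q (P x) by rewrite QE -PE; exists x.
    by rewrite bopME -yx -bopME QQ.
  have PQ : P * Q = Q.
    apply: bopP => x; have [y _ yx] : range P (Q x) by rewrite PE -QE; exists x.
    by rewrite bopME -yx -bopME PP.
  have aPQ : isadj P Q by have := isadjM Qa Pa; rewrite QP PQ.
  by rewrite -(adjE aPQ) (adjE Pa).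
by case; split=> //; exact: adjE.
Qed.

End Projections.

(** * The base projection, its reflection and orbits in the sphere *)

Section Sphere.
Variables (R : realType) (V : lmodType R[i]) (dot : inner V).
Notation BB := (bop (sum_inner dot)).
Notation p0 := (base_proj dot).
Implicit Types (p q X Y J : BB) (U : R -> BB) (c : R -> BB) (s t : R).

Lemma base_projM : p0 * p0 = p0.
Proof. by rewrite blockM !(mulr0, mul0r, addr0, mul1r). Qed.

Lemma base_proj_isadj : isadj p0 p0.
Proof. by apply: block_isadj; first exact: isadj1; exact: isadj0. Qed.

Lemma base_proj_norm : `|p0| <= 1.
Proof.
apply: bop_norm_le => // x; rewrite mul1r.
rewrite -(@ler_pXn2r _ 2) ?nnegrE ?inorm_ge0 // !inorm_sum /= ?bop0E ?bop1E.
by rewrite !addr0 inorm0 expr0n addr0 lerDl sqr_ge0.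
Qed.

Lemma PGr0 : PGr dot (linop_of_bop (0 : bop dot)) = p0.
Proof.
apply: orthoprojE; [exact: base_projM|exact: base_proj_isadj|].
apply/seteqP; split=> [_ [x _ <-]|[x y] [_ /= ->]].
  by split => //=; rewrite ?bop0E addr0.
by exists (x, 0) => //=; rewrite ?bop0E ?bop1E !addr0.
Qed.

Definition reflection : BB := p0 + p0 - 1.
Notation rho := reflection.

Lemma rhoM : rho * rho = 1.
Proof.
rewrite mulrBr mulr1 mulrBl mul1r mulrDr !mulrDl !base_projM.
by rewrite addrK opprB addrCA subrr addr0.
Qed.

Lemma rho_isadj : isadj rho rho.
Proof.
apply: isadjB; last exact: isadj1.
by apply: isadjD; exact: base_proj_isadj.
Qed.

Lemma rho_norm : `|rho| <= 1.
Proof. exact: isadj_isometry_norm rho_isadj rhoM. Qed.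

Lemma rho_p0 : rho * p0 = p0.
Proof. by rewrite mulrBl mulrDl base_projM mul1r addrK. Qed.

Lemma p0_rho : p0 * rho = p0.
Proof. by rewrite mulrBr mulrDr base_projM mulr1 addrK. Qed.

(** As [p0 = (1 + rho) / 2], this is half a commutator with a contraction. The direct estimate would
    give 2 and double the bound [pi / 2]. *)
Lemma commutator_norm J : `|J| <= 1 -> `|J * p0 - p0 * J| <= 1.
Proof.
move=> J1; rewrite (_ : _ - _ = (2^-1 : R) *: (J * rho - rho * J)).
  rewrite normrZ gtr0_norm ?invr_gt0 // ler_pdivrMl // mulr1.
  rewrite (le_trans (ler_normB _ _)) // (_ : 2 = 1 + 1) //.
  by apply: lerD; rewrite (le_trans (bop_normM _ _)) // mulr_ile1 ?rho_norm.
rewrite mulrBr mulrBl mulr1 mul1r opprB addrA subrK mulrDr mulrDl.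
rewrite opprD addrACA -[X in _ *: (X + _)]scale1r -[X in _ *: (_ + X)]scale1r.
by rewrite -scalerDl scalerA mulVf ?scale1r.
Qed.

Lemma orbit_sphere U J t : unitary_group U J -> riemann_sphere (orbit U p0 t).
Proof.
move=> UJ; exists (U t); first exact: group_unitary UJ t.
by rewrite (group_adj UJ).
Qed.

Lemma orbit0 U J p : unitary_group U J -> orbit U p 0 = p.
Proof. by case=> _ U0 _ _; rewrite /orbit oppr0 U0 mul1r mulr1. Qed.

Lemma sphere_curve_orbit U J c (a b : R) : unitary_group U J -> a < b ->
  {in `[a, b], c =1 orbit U p0} -> sphere_curve c a b.
Proof.
move=> UJ ab cU; split.
  exists [:: b]; first exact: itv_partition1.
  case=> //= _; apply: C1_on_ext (orbit_C1 UJ p0 a b) => t /cU.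
  by [].
by move=> t /cU ->; exact: orbit_sphere UJ.
Qed.

Lemma dist_le_length c (a b : R) : a <= b -> sphere_curve c a b ->
  (dist (c a) (c b) <= length c a b)%E.
Proof. by move=> ab sc; apply: ereal_inf_lbound; exists c, a, b. Qed.

End Sphere.

(** The difference [sin (s h) - (exp (r h) - 1)] vanishes at [h = 0] with derivative [s - r > 0].
    Dyadic [h] are what the doubling argument can use. *)
Lemma expR_sin_small (R : realType) (r s : R) : r < s ->
  exists n, expR (r / 2 ^+ n) - 1 <= sin (s / 2 ^+ n).
Proof.
move=> rs; pose F h := sin (s * h) - (expR (r * h) - 1).
have F0 : F 0 = 0 by rewrite /F !mulr0 sin0 expR0 !subrr.
have dl k : is_derive (0 : R) (1 : R) (fun h => k * h) k.
  apply/is_deriveP; apply: cvg_near_cst; near=> h.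
  rewrite addr0 mulr0 subr0 /GRing.scale /= mulrCA mulVf ?mulr1 //.
  by near: h; exact: nbhs_dnbhs_neq.
have dF : is_derive (0 : R) (1 : R) F (s - r).
  have d1 : is_derive (0 : R) (1 : R) (sin \o (fun h => s * h)) (cos (s * 0) * s).
    exact: is_derive1_comp.
  have d2 : is_derive (0 : R) (1 : R) (expR \o (fun h => r * h)) (expR (r * 0) * r).
    exact: is_derive1_comp.
  have -> : F = (sin \o (fun h => s * h)) - ((expR \o (fun h => r * h)) - cst 1).
    by apply/funext.
  by apply: is_derive_eq; rewrite !mulr0 cos0 expR0 subr0 !mul1r.
have /is_deriveP/cvgr_gt/(_ 0) := dF; rewrite subr_gt0 => /(_ rs).
rewrite near_withinE F0 => Fpos.
have : (2^-1 : R) ^+ n @[n --> \oo] --> (0 : R).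
  by apply: cvg_expr; rewrite ger0_norm ?invr_ge0 // invf_lt1 ?ltr1n.
move=> /(_ _ Fpos)[n _ /(_ n (leqnn n))] /=; rewrite exprVn => h.
exists n; have n0 : 0 < (2 ^+ n)^-1 :> R by rewrite invr_gt0 exprn_gt0.
rewrite -subr_ge0 ltW //; move: (h (lt0r_neq0 n0)).
by rewrite addr0 subr0 /GRing.scale /= pmulr_rgt0 ?invr_gt0.
Unshelve. all: by end_near. Qed.

(** * The diameter bound and the lower bound for the cosine block *)

Section Diameter.
Variables (R : realType) (V : lmodType R[i]) (dot : inner V).
Hypothesis dotC : inner_complete dot.
Notation BB := (bop (sum_inner dot)).
Notation p0 := (base_proj dot).
Notation rho := (reflection dot).
Implicit Types (p q X Y J w : BB) (U : R -> BB) (c : R -> BB) (s t : R).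

Lemma iZ_isadj w : isadj w w -> isadj (bopZC 'i%C w) (- bopZC 'i%C w).
Proof.
move=> ww x y; rewrite bopNE /= linearNr linearZl_LR linearZr_LR /= ww.
by rewrite -mulNr; congr (_ * _); apply/eqP; rewrite eq_complex /= oppr0 opprK !eqxx.
Qed.

Lemma iZ_sqr w : w * w = 1 -> bopZC 'i%C w * bopZC 'i%C w = - 1.
Proof.
move=> ww; apply: bopP => x; rewrite bopNE bop1E bopME /= linearZ scalerA.
transitivity (('i%C * 'i%C : R[i]) *: (w * w) x) => //.
rewrite ww bop1E -[RHS]scaleN1r; congr (_ *: _).
by apply/eqP; rewrite eq_complex /=; apply/andP; split; apply/eqP; ring.
Qed.

Lemma iZ_conj w q : bopZC 'i%C w * q * - bopZC 'i%C w = w * q * w.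
Proof.
apply: bopP => x; rewrite !bopME bopNE.
transitivity ('i%C *: w (q (- ('i%C *: w x)))) => //.
rewrite !linearN !linearZ /= ?scalerN !scalerA -?scaleNr. rewrite -[RHS]scale1r; congr (_ *: _).
by apply/eqP; rewrite eq_complex /=; apply/andP; split; apply/eqP; ring.
Qed.

(* A symmetry exchanging [p0] and [q] is the endpoint [i w] of a rotation group,
   whose orbit joins [p0] to [q]. *)
Lemma dist_symmetry w : isadj w w -> w * w = 1 ->
  (dist p0 (w * p0 * w)%R <= (pi / 2)%:E)%E.
Proof.
move=> wa ww; pose J := bopZC 'i%C w.
have Ja : isadj J (- J) by exact: iZ_isadj.
have JJ : J * J = - 1 by exact: iZ_sqr.
have UJ := rotation_group Ja JJ; set U := (fun t => _) in UJ.
have pi20 : 0 < pi / 2 :> R by rewrite divr_gt0 ?pi_gt0.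
have sc : sphere_curve (orbit U p0) 0 (pi / 2).
  by apply: sphere_curve_orbit UJ _ _.
have E0 : orbit U p0 0 = p0 by exact: orbit0 UJ.
have E1 : orbit U p0 (pi / 2) = w * p0 * w.
  rewrite /orbit /U cosN sinN cos_pihalf sin_pihalf !scale0r !add0r scale1r scaleN1r.
  exact: iZ_conj.
have := dist_le_length (ltW pi20) sc; rewrite E0 E1 => /le_trans; apply.
rewrite (orbit_length UJ (p := p0) (ltW pi20)) // subr0 lee_fin.
rewrite ler_piMr ?(ltW pi20) //; apply: commutator_norm.
apply: isadj_isometry_norm Ja _.
by rewrite mulNr JJ opprK.
Qed.

Lemma rho_anticomm X : X * p0 + p0 * X = X -> rho * X = - (X * rho).
Proof.
move=> Xp; apply/eqP; rewrite -addr_eq0 mulrBl mulrBr mul1r mulr1 mulrDl mulrDr.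
rewrite addrACA [p0 * X + _ + _]addrACA [p0 * X + _]addrC Xp.
by rewrite addrACA subrr addr0.
Qed.

Lemma tangent_rho X : X * p0 + p0 * X = X -> X * p0 - p0 * X = X * rho.
Proof.
by move=> Xp; rewrite mulrBr mulr1 mulrDr -{5}Xp opprD addrA addrK.
Qed.

Lemma tangent_p0 X : X * p0 + p0 * X = X -> p0 * X * p0 = 0.
Proof.
move=> Xp; have : p0 * X = p0 * X * p0 + p0 * X.
  by rewrite -{1}Xp mulrDr !mulrA base_projM.
by move/eqP; rewrite -subr_eq subrr eq_sym => /eqP.
Qed.

(** The left side is the initial velocity of the orbit generated by [Y], so the geodesic leaves with
    velocity [X]. It holds because [p0 * X * p0 = 0]. *)
Lemma tangent_bracket X (Y := X * p0 - p0 * X) : X * p0 + p0 * X = X ->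
  Y * p0 - p0 * Y = X.
Proof.
move=> Xp; have pXp := tangent_p0 Xp.
rewrite /Y mulrBl mulrBr -(mulrA X) base_projM !mulrA base_projM pXp.
by rewrite subr0 sub0r opprK.
Qed.

Lemma tangent_skew X (Y := X * p0 - p0 * X) : isadj X X -> isadj Y (- Y).
Proof.
move=> Xa; rewrite /Y opprB; have pa := base_proj_isadj dot.
by apply: isadjB; exact: isadjM.
Qed.

Section Geodesics.
Variable X : BB.
Hypotheses (Xa : isadj X X) (Xp : X * p0 + p0 * X = X).
Let Y := X * p0 - p0 * X.
Let E t := opexp (t *: Y).

Let BBC : inner_complete (sum_inner dot) := sum_inner_complete dotC.

Lemma geodesic_group : unitary_group E Y.
Proof. by apply: opexp_group => //; exact: tangent_skew. Qed.

Lemma rho_exp t : rho * E t = E (- t) * rho.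
Proof.
apply: opexp_anticomm => //; rewrite /Y tangent_rho // mulrA rho_anticomm //.
by rewrite mulNr.
Qed.

Lemma dist_half_pi : (dist p0 (orbit E p0 1) <= (pi / 2)%:E)%E.
Proof.
have [ED E0 Eadj _] := geodesic_group.
have ra := rho_isadj dot.
have EN : rho * E (- 1) = E 1 * rho by rewrite rho_exp opprK.
have wa : isadj (E 1 * rho) (E 1 * rho).
  by rewrite -{2}EN; apply: isadjM.
have ww : E 1 * rho * (E 1 * rho) = 1.
  by rewrite -{2}EN mulrA -(mulrA (E 1) rho rho) rhoM mulr1 -ED subrr.
have := dist_symmetry wa ww; rewrite /orbit; congr (dist _ _ <= _)%E.
rewrite -{2}EN mulrA -(mulrA (E 1) rho p0) rho_p0 -(mulrA (E 1) p0 rho).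
by rewrite p0_rho.
Qed.

Definition cos_bound t (m : R) := forall x, p0 x = x ->
  m * inorm (sum_inner dot) x ^+ 2 <= rdot (sum_inner dot) (E t x) x.

Lemma p0_pythagoras x : inorm (sum_inner dot) x ^+ 2 =
  inorm (sum_inner dot) (p0 x) ^+ 2 + inorm (sum_inner dot) (x - p0 x) ^+ 2.
Proof.
have pa := base_proj_isadj dot.
have h : rdot (sum_inner dot) (p0 x) (p0 x) = rdot (sum_inner dot) (p0 x) x.
  by rewrite -(isadj_rdot _ _ pa) -bopME base_projM.
rewrite -!rdotxx rdotBl !rdotBr !h [rdot _ x (p0 x)]rdotC; ring.
Qed.

(** Moving one factor across gives [<E t x, E (- t) x>], and [E (- t) x = rho (E t x)] with
    [rho = 2 p0 - 1]. *)
Lemma exp_double t x : p0 x = x -> rdot (sum_inner dot) (E (t + t) x) x =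
  2 * inorm (sum_inner dot) (p0 (E t x)) ^+ 2 - inorm (sum_inner dot) x ^+ 2.
Proof.
move=> px; have [ED E0 Eadj _] := geodesic_group.
have pa := base_proj_isadj dot.
have rx : rho x = x by rewrite bopBE bopDE px bop1E addrK.
rewrite ED bopME (isadj_rdot _ _ (Eadj t)).
have -> : E (- t) x = rho (E t x) by rewrite -bopME rho_exp bopME rx.
set y := E t x; rewrite bopBE bopDE bop1E rdotBr rdotDr.
have -> : rdot (sum_inner dot) y (p0 y) = inorm (sum_inner dot) (p0 y) ^+ 2.
  by rewrite -rdotxx (isadj_rdot _ _ pa) -bopME base_projM.
rewrite rdotxx (group_isometry geodesic_group); ring.
Qed.

(** Because [p0 x = x], the form is [<p0 (E t x), x>], and Cauchy-Schwarz turns the bound into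
    [m |x| <= |p0 (E t x)|], which is squared in [exp_double]. *)
Lemma cos_bound_double t m : 0 <= m -> cos_bound t m ->
  cos_bound (t + t) (2 * m ^+ 2 - 1).
Proof.
move=> m0 tm x px; rewrite exp_double // mulrBl mul1r lerB // -mulrA ler_wpM2l //.
rewrite -exprMn ler_pXn2r ?nnegrE ?mulr_ge0 ?inorm_ge0 //.
have [->|x0] := eqVneq (inorm (sum_inner dot) x) 0; first by rewrite mulr0 inorm_ge0.
have {}x0 : 0 < inorm (sum_inner dot) x by rewrite lt_neqAle eq_sym x0 inorm_ge0.
rewrite -(ler_pM2r x0) -mulrA -expr2 (le_trans (tm x px)) //.
rewrite -{2}px -(isadj_rdot _ _ (base_proj_isadj dot)).
by rewrite (le_trans (ler_norm _)) // norm_rdot.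
Qed.

(** The component of [E t x] off the first summand is that of [(E t - 1) x], hence at most [m |x|].
    Passing through [exp_double] makes the loss quadratic in [m], as for the cosine; bounding
    [E t - 1] directly would lose a first-order term. *)
Lemma cos_bound_small t m : expR (`|t| * `|Y|) - 1 <= m ->
  cos_bound (t + t) (1 - 2 * m ^+ 2).
Proof.
move=> tm x px; rewrite exp_double //.
set n := inorm _; set y := E t x.
have ny : n y = n x by exact: (group_isometry geodesic_group).
have h := p0_pythagoras y.
have hm : n (y - p0 y) <= m * n x.
  have -> : y - p0 y = (1 - p0) ((E t - 1) x).
    have pB z : p0 (z - x) = p0 z - x by rewrite -{2}px; exact: linearB.
    by rewrite !bopBE !bop1E pB opprB addrA subrK.
  rewrite (le_trans (bop_normE _ _)) //.
  have q1 : `|1 - p0| <= 1.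
    apply: bop_norm_le => // z; rewrite mul1r bopBE bop1E.
    rewrite -(@ler_pXn2r _ 2) ?nnegrE ?inorm_ge0 //.
    by rewrite [leRHS]p0_pythagoras lerDr sqr_ge0.
  rewrite (le_trans (ler_wpM2r _ q1)) ?inorm_ge0 // mul1r.
  rewrite (le_trans (bop_normE _ _)) // ler_wpM2r ?inorm_ge0 //.
  by rewrite (le_trans (opexp_sub1 _ _ _)).
have m0 : 0 <= m by rewrite (le_trans _ tm) // subr_ge0 -expR0 ler_expR mulr_ge0.
have hm2 : n (y - p0 y) ^+ 2 <= (m * n x) ^+ 2.
  by rewrite ler_pXn2r ?nnegrE ?mulr_ge0 ?inorm_ge0.
move: h; rewrite -/n ny => h.
rewrite exprMn in hm2; lra.
Qed.

Lemma cos_bound_dyadic n t v : 0 <= v <= pi / 2 ->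
  cos_bound (t / 2 ^+ n) (cos (v / 2 ^+ n)) -> cos_bound t (cos v).
Proof.
elim: n t v => [|n IH] t v /andP[v0 v1]; first by rewrite expr0 !divr1.
have v2 : 0 <= v / 2 <= pi / 2 by apply/andP; split; have := pi_ge0 R; lra.
rewrite exprS invfM !mulrA => /(IH _ _ v2).
move=> /cos_bound_double; rewrite -splitr => h.
have -> : cos v = 2 * cos (v / 2) ^+ 2 - 1.
  by rewrite {1}[v]splitr cosD -!expr2 sin2cos2; ring.
(* Halved angles stay below [pi / 2], which keeps the bound to be doubled nonnegative. *)
apply: h; apply: cos_ge0_pihalf.
by move: v2 => /andP[? ?]; apply/andP; split => //; lra.
Qed.

Lemma cos_bound_gt0 t : 0 <= t -> t * `|Y| < pi / 2 ->
  exists2 m, 0 < m <= 1 & cos_bound t m.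
Proof.
(* The midpoint leaves room on both sides: above [t * |Y|] for the sine to dominate [expR - 1],
   below [pi / 2] for [cos v] to be positive. *)
move=> t0 tY; pose v := (t * `|Y| + pi / 2) / 2.
have tv : t * `|Y| < v by rewrite /v; lra.
have v0 : 0 <= v by rewrite (le_trans _ (ltW tv)) ?mulr_ge0.
have v1 : v < pi / 2 by rewrite /v; lra.
exists (cos v); first by rewrite cos_le1 andbT cos_gt0_pihalf //; lra.
(* Both quantities are halved because [cos_bound_small] takes an estimate at time [t] and concludes
   at [t + t]. *)
have tv2 : t * `|Y| / 2 < v / 2 by lra.
have [n hn] := expR_sin_small tv2.
apply: (@cos_bound_dyadic n); first by rewrite v0 ltW.
have -> : cos (v / 2 ^+ n) = 1 - 2 * sin (v / 2 / 2 ^+ n) ^+ 2.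
  have -> : v / 2 ^+ n = v / 2 / 2 ^+ n + v / 2 / 2 ^+ n.
    by rewrite -mulrDl -splitr.
  by rewrite cosD -!expr2 cos2sin2; ring.
have -> : t / 2 ^+ n = t / 2 / 2 ^+ n + t / 2 / 2 ^+ n.
  by rewrite -mulrDl -splitr.
apply: cos_bound_small; apply: le_trans hn.
rewrite lerB // ler_expR ger0_norm; last by rewrite !divr_ge0.
by rewrite le_eqVlt; apply/orP; left; apply/eqP; ring.
Qed.

End Geodesics.

End Diameter.

(** * Tails of minimal orbits *)

Section MinimalOrbits.
Variables (R : realType) (V : lmodType R[i]) (dot : inner V).
Notation BB := (bop (sum_inner dot)).
Notation p0 := (base_proj dot).
Variables (U : R -> BB) (J : BB).
Hypothesis UJ : unitary_group U J.
Implicit Types (p q : BB) (s t : R).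

(** [U t] commutes with the difference quotients of [U] at 0, hence with their limit. *)
Lemma orbit_generator t : orbit U J t = J.
Proof.
have [UD _ _ UJ0] := UJ.
have h : U t * (h^-1 *: (U h - 1)) * U (- t) @[h --> (0 : R)^'] --> U t * J * U (- t).
  apply: bop_cvgM; last exact: cvg_cst.
  by apply: bop_cvgM => //; exact: cvg_cst.
apply: (cvg_unique _ h) => //; rewrite (_ : (fun s => _) = (fun s => s^-1 *: (U s - 1))) //.
apply/funext => s; rewrite -bopZAr -bopZAl; congr (_ *: _).
rewrite mulrBr mulr1 mulrBl (groupN UJ) -!UD addrAC subrr add0r.
by [].
Qed.

Lemma orbitM p q t : orbit U (p * q) t = orbit U p t * orbit U q t.
Proof.
by rewrite /orbit !mulrA -(mulrA _ (U (- t))) (groupVN UJ) mulr1.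
Qed.

Lemma orbit_commutator_norm p t :
  `|J * orbit U p t - orbit U p t * J| = `|J * p - p * J|.
Proof.
rewrite -(orbit_norm UJ (J * p - p * J) t) -{1 2}(orbit_generator t) -!orbitM.
by rewrite /orbit -mulrBl -mulrBr.
Qed.

Lemma orbit_orbit p s t : orbit U (orbit U p s) t = orbit U p (s + t).
Proof.
have [UD _ _ _] := UJ.
by rewrite /orbit opprD [s + t]addrC !UD !mulrA.
Qed.

(** An orbit arc of duration [s] is put in front of each competitor. Its length is finite, so it can
    be subtracted, which leaves a lower bound for an infimum. *)
Lemma dist_orbit_triangle s q : 0 < s ->
  (dist p0 q <= dist (orbit U p0 s) q + (s * `|J * p0 - p0 * J|)%:E)%E.
Proof.
move=> s0; rewrite -leeBlDr //.
apply: le_ereal_inf_tmp => _ [d [a [b [ab [dC1 dS] da db ->]]]].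
rewrite leeBlDr //.
(* The shift by [k] makes the arc leave [p0] at time [a - s] and meet [d] at time [a]. *)
set k := s - a; set c := orbit U (orbit U p0 k).
have am : a - s < a by rewrite ltrBlDr ltrDl.
have cE t : c t = orbit U p0 (k + t) by rewrite /c orbit_orbit.
have ca : c a = d a by rewrite cE /k subrK da.
have cC1 : C1_on c (a - s) a by exact: orbit_C1 UJ _ _ _.
have len := length_concat am ab cC1 dC1 ca.
have cl : length c (a - s) a = (s * `|J * p0 - p0 * J|)%:E.
  rewrite (orbit_length UJ (p := orbit U p0 k) (ltW am)) //.
  by rewrite orbit_commutator_norm opprB addrC subrK.
rewrite addeC -cl -len.
apply: ereal_inf_lbound; exists (concat c d a), (a - s), b.
split=> //.
- exact: le_trans (ltW am) ab.
- split; first exact: piecewise_C1_concat.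
  move=> t; rewrite in_itv /= => /andP[_ tb]; rewrite /concat; case: ltP => ta.
    by rewrite cE; exact: orbit_sphere UJ.
  by apply: dS; rewrite in_itv /= ta.
- rewrite /concat am cE (_ : k + (a - s) = 0); last by rewrite /k; ring.
  exact: orbit0 UJ.
- by rewrite /concat ltNge ab.
Qed.

Lemma dist_minimal_orbit c t : {in `[0, 1], c =1 orbit U p0} ->
  length c 0 1 = dist (c 0) (c 1) -> t \in `[0, 1[ ->
  length c t 1 = dist (c t) (c 1) /\
  dist (c t) (c 1) = ((1 - t) * `|J * p0 - p0 * J|)%:E.
Proof.
move=> cU cmin; rewrite in_itv /= => /andP[t0 t1].
have c0 : c 0 = p0 by rewrite cU ?in_itv /= ?lexx ?ler01 // (orbit0 _ UJ).
have len s : 0 <= s -> s < 1 -> length c s 1 = ((1 - s) * `|J * p0 - p0 * J|)%:E.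
  move=> s0 s1; apply: (orbit_length UJ); first exact: ltW.
  move=> u; rewrite in_itv /= => /andP[su u1]; apply: cU.
  by rewrite in_itv /= (ltW u1) (le_trans s0) // ltW.
suff E : dist (c t) (c 1) = ((1 - t) * `|J * p0 - p0 * J|)%:E by rewrite E len.
apply/le_anti/andP; split.
  rewrite -len //; apply: dist_le_length; first exact: ltW.
  apply: sphere_curve_orbit UJ t1 _ => u; rewrite in_itv /= => /andP[tu u1].
  by apply: cU; rewrite in_itv /= u1 (le_trans t0).
(* At [t = 0] there is no arc to prepend, and the claim is minimality itself. *)
move: t0; rewrite le_eqVlt => /predU1P[<-|t0].
  by rewrite -cmin len.
have := dist_orbit_triangle (c 1) t0.
rewrite -cU ?in_itv /= ?(ltW t0) ?(ltW t1) // -{1}c0 -cmin len // subr0 mul1r.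
rewrite -leeBlDr // -EFinB; congr (_%:E <= _)%E.
by rewrite mulrBl mul1r.
Qed.

End MinimalOrbits.

(** * The orbit as a path of graphs *)

Section GraphDeformation.
Variables (R : realType) (V : lmodType R[i]) (dot : inner V).
Hypothesis dotC : inner_complete dot.
Notation p0 := (base_proj dot).
Variables (a b : bop dot).
Hypothesis ab : isadj a b.
Let Y := block 0 (- a) b 0.
Let E t := opexp (t *: Y).
Let S t := opabs (t *: b).
Let C t := opcos (S t).
Let M t := (t *: b) * opsinc (S t).
Hypothesis EY : unitary_group E Y.
Implicit Types (s t : R).

Lemma exp_col t : E t * p0 = block (C t) 0 (M t) 0.
Proof.
have [_ SS _] := opabsP dotC (isadjZ t (isadj_sym ab)).
rewrite /E blockZ !scaler0 scalerN; exact: opexp_col.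
Qed.

Lemma exp_colE t x : E t (x, 0) = (C t x, M t x).
Proof.
have -> : E t (x, 0) = (E t * p0) (x, 0).
  by rewrite bopME /= ?bop0E ?bop1E !addr0.
by rewrite exp_col /= ?bop0E !addr0.
Qed.

(** Both entries are read off from the first column of the continuous group [E], which bypasses the
    continuity of [opabs]. *)
Lemma cvg_col t : C s @[s --> t] --> C t /\ M s @[s --> t] --> M t.
Proof.
apply/cvg_block_col; rewrite -exp_col.
rewrite (_ : (fun s => _) = (fun s => E s * p0)).
  by apply: bop_cvgM; [exact: group_continuous EY _|exact: cvg_cst].
by apply/funext => s; rewrite exp_col.
Qed.

Lemma cos_norm t : `|C t| <= 1.
Proof.
apply: le_trans (block_col_norml (C t) (M t)) _; rewrite -exp_col.
apply: le_trans (bop_normM _ _) _.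
by rewrite mulr_ile1 ?(group_norm EY) ?base_proj_norm.
Qed.

Lemma cos_block_invertible t (m : R) : 0 < m <= 1 ->
  (forall x, p0 x = x -> m * inorm (sum_inner dot) x ^+ 2 <=
     rdot (sum_inner dot) (E t x) x) ->
  invertible (C t).
Proof.
move=> m01 mC; apply: (coercive_invertible dotC m01 (cos_norm t)) => x.
have := mC (x, 0); rewrite /= ?bop0E ?bop1E !addr0 => /(_ erefl).
rewrite inorm_sum /= inorm0 expr0n addr0 exp_colE.
rewrite /rdot /= /sum_inner /=. by rewrite linear0r addr0.
Qed.

(** The range of the conjugated projection is the image of the first summand under [E t], namely the
    pairs [(C t x, M t x)]; inverting [C t] parametrizes them by the first component. *)
Lemma orbit_graph t : invertible (C t) ->
  orbit E p0 t = PGr dot (linop_of_bop (M t * opinv (C t))).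
Proof.
move=> /opinvP[CI IC]; have [ED _ Eadj _] := EY; apply/esym.
have pa := base_proj_isadj dot.
apply: orthoprojE.
- by rewrite -(orbitM EY) base_projM.
- have := isadjM (isadjM (Eadj t) pa) (Eadj (- t)).
  by rewrite opprK /orbit mulrA.
apply/seteqP; split=> [_ [x _ <-]|[x y] [_ /= ->]].
  rewrite /orbit exp_col bopME /=; set z := (E (- t) x).1.
  by split=> //=; rewrite ?bop0E !addr0 -!bopME -mulrA IC mulr1.
(* The factor [E (- t)] of the orbit cancels this [E t]. *)
exists (E t (opinv (C t) x, 0)) => //.
transitivity ((E t * p0 * (E (- t) * E t)) (opinv (C t) x, 0)).
  by rewrite /orbit !mulrA.
rewrite (groupVN EY) mulr1 exp_col /= ?bop0E !addr0.
by rewrite -bopME CI.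
Qed.

End GraphDeformation.

(** * Optimality of the bounded deformation *)

Theorem corollary5p13 (R : realType) (H : hilbertType R)
    (T : linop H)
    (T_dense : dense (dom T))
    (T_closed : closed (graph T))
    (T_unbounded : unbounded (@hdot R H) T)
    (gamma : R -> BHH H)
    (gamma0 : gamma 0 = PGr hdot (linop_of_bop (0 : BH H)))
    (gamma1 : gamma 1 = PGr hdot T)
    (gamma_min : minimal_geodesic gamma)
    (a : BH H)
    (gamma_a : h^-1 *: (gamma h - gamma 0) @[h --> (0 : R)^'+]
                 --> block 0 a (adj a) 0) :
  let Tt := fun t : R =>
    (t *: adj a) * opsinc (opabs (t *: adj a))
      * opinv (opcos (opabs (t *: adj a))) in
  [/\ forall t, t \in `[0, 1[ -> invertible (opcos (opabs (t *: adj a))),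
      forall v : BH H, polar_decomposition (adj a) v ->
        forall t, t \in `[0, 1[ -> Tt t = v * optan (opabs (t *: adj a)),
      forall t, t \in `[0, 1[ -> gamma t = PGr hdot (linop_of_bop (Tt t)),
      bounded_deformation T 1 Tt &
      optimal T 1 Tt].
Proof.
have dotC := @hilbert_complete _ H.
have dotC2 := sum_inner_complete dotC.
rewrite PGr0 in gamma0.
case: gamma_min => -[X]; rewrite gamma0 => -[/selfadjP Xa Xp] gammaE gamma_min.
set p := base_proj hdot in gammaE Xp gamma0 gamma_min.
set Y := X * p - p * X in gammaE.
pose E t := opexp (t *: Y).
have EY : unitary_group E Y by exact: geodesic_group.
have gE : {in `[0, 1], gamma =1 orbit E p}.
  by move=> t /gammaE ->; rewrite /orbit /E scaleNr.
have YX : Y * p - p * Y = X by exact: tangent_bracket.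
(* The given velocity is a right derivative, since [gamma] is only controlled on [[0, 1]]; there it
   agrees with the orbit, whose two-sided derivative at 0 is [X]. *)
have XE : X = block 0 a (adj a) 0.
  have : h^-1 *: (gamma h - gamma 0) @[h --> (0 : R)^'+] --> X.
    have : h^-1 *: (E h * p * E (- h) - p) @[h --> (0 : R)^'+] --> X.
      by apply: cvg_dnbhs_at_right; rewrite -[X in _ --> X]YX; exact: orbit_quotient0.
    apply: cvg_trans; apply: near_eq_cvg; near=> h.
    rewrite gE ?gamma0 // in_itv /=; apply/andP; split=> //.
    by near: h; exact: nbhs_right_le.
  move=> /cvg_unique; apply=> //.
(* Self-adjointness of [X], tested on vectors of different summands, shows that [adj a] is a genuine
   adjoint and not the default value. *)
have ab : isadj a (adj a).
  move=> x y; have := Xa (0, x) (y, 0).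
  by rewrite XE /= /sum_inner /= !addr0 !add0r !linear0 ?linear0l ?linear0r ?add0r ?addr0.
set b := adj a in XE ab *.
have YE : Y = block 0 (- a) b 0.
  rewrite /Y XE /p !blockM !(mulr0, mul0r, addr0, add0r, mulr1, mul1r).
  by rewrite -scaleN1r blockZ blockD !scaleN1r !(subr0, sub0r, oppr0, addr0).
have lenE : length gamma 0 1 = (`|X|)%:E.
  rewrite (orbit_length EY (p := p) ler01) ?subr0 ?mul1r ?YX // => t t01.
  by apply: gE; exact: subset_itv_oo_cc t01.
have X_le : `|X| <= pi / 2.
  have := dist_half_pi dotC Xa Xp; rewrite -lee_fin -lenE gamma_min.
  by rewrite gE ?in_itv /= ?lexx ?ler01.
have YX_le : `|Y| <= `|X|.
  rewrite /Y tangent_rho // (le_trans (bop_normM _ _)) // ler_piMr //.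
  exact: rho_norm.
set Tt := fun t => _.
pose C t := opcos (opabs (t *: b)).
have cosI t : t \in `[0, 1[ -> invertible (C t).
  rewrite in_itv /= => /andP[t0 t1].
  have tY : t * `|Y| < pi / 2.
    (* The strict inequality comes from [t < 1] when [|Y| > 0], and from [0 < pi / 2] otherwise. *)
    have [->|Y0] := eqVneq `|Y| 0; first by rewrite mulr0 divr_gt0 ?pi_gt0.
    have Ygt : 0 < `|Y| by rewrite lt_neqAle eq_sym Y0 /=.
    by rewrite (lt_le_trans _ (le_trans YX_le X_le)) // gtr_pMl.
  have [m m01 hm] := cos_bound_gt0 dotC Xa Xp t0 tY.
  apply: (cos_block_invertible dotC ab _ m01); rewrite -YE; [exact: EY|exact: hm].
have gT t : t \in `[0, 1[ -> gamma t = PGr hdot (linop_of_bop (Tt t)).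
  move=> t01; rewrite gE; last exact: subset_itv_co_cc t01.
  rewrite /E YE; apply: (orbit_graph dotC ab); last exact: cosI.
  by rewrite -YE; exact: EY.
have dist_tail t : t \in `[0, 1[ -> length gamma t 1 = dist (gamma t) (gamma 1) /\
    dist (gamma t) (gamma 1) = ((1 - t) * `|X|)%:E.
  have gm : length gamma 0 1 = dist (gamma 0) (gamma 1) by rewrite gamma0.
  by move=> t01; have := dist_minimal_orbit EY gE gm t01; rewrite YX.
split.
- exact: cosI.
- move=> v [_ _ bv] t; rewrite in_itv /= => /andP[t0 t1].
  have [_ _ Suniq] := opabsP dotC (isadjZ t (isadj_sym ab)).
  have [S0 SS _] := opabsP dotC (isadj_sym ab).
  (* For [t >= 0] the right side is positive with the right square, so uniqueness applies; then
     [t *: b = v * opabs (t *: b)]. *)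
  have tS : opabs (t *: b) = t *: opabs b.
    apply: Suniq; last by rewrite -!bopZAl -!bopZAr SS.
    apply: positiveP => [|x]; first exact/isadjZ/positive_isadj.
    by rewrite bopZE rdotZl mulr_ge0 ?positive_re.
  rewrite /Tt /optan /opsin !mulrA; congr (_ * _ * _).
  by rewrite tS -bopZAr -bv.
- exact: gT.
- split=> //.
    apply/subspace_continuousP => t t01.
    have bY : unitary_group (fun s => opexp (s *: block 0 (- a) b 0)) (block 0 (- a) b 0).
      by rewrite -YE.
    have [Ct Mt] := cvg_col dotC ab bY t.
    apply: bop_cvgM; first exact: cvg_within_filter.
    (* The filter is confined to [[0, 1[], where the cosines are known to be invertible. *)
    apply: cvg_opinv; [exact: cvg_within_filter|exact: cosI|].
    by rewrite near_withinE; apply: nearW => s; exact: cosI.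
  rewrite -gamma1.
  have lim : ((1 - t) * `|X|)%:E @[t --> (1 : R)^'-] --> 0%E.
    apply: cvg_EFin; first exact: nearW.
    rewrite -[X in _ --> X](mul0r `|X|); apply: cvgMr_tmp.
    rewrite -[X in _ --> X](subrr 1); apply: cvgB; first exact: cvg_cst.
    exact: cvg_at_left_filter.
  apply: cvg_trans lim; apply: near_eq_cvg; near=> t.
  have t01 : t \in `[0, 1[.
    rewrite in_itv /=; apply/andP; split=> //.
    by apply: ltW; near: t; exact: nbhs_left_gt.
  by rewrite -gT // (dist_tail t t01).2.
- rewrite /optimal /=; set P := deformation_curve T 1 Tt => t0 t01.
  (* From time 1 on [P] stays at the projection onto the graph of [T], so the agreement with the
     orbit holds only up to 1; lengths and distances on [[0, 1]] see nothing else, and the result on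
     minimal orbits applies to [P] itself. *)
  have PE : {in `[0, 1], P =1 orbit E p}.
    move=> t t01'; rewrite /P /deformation_curve; case: ltP => [t1|t1].
      rewrite -gT ?gE //; move: t01'; rewrite !in_itv /= => /andP[-> _].
      by rewrite t1.
    have -> : t = 1 by apply/le_anti; rewrite t1 andbT; case/andP: t01'.
    by rewrite -gamma1 gE // in_itv /= lexx ler01.
  have Pg t : t \in `[0, 1] -> P t = gamma t by move=> t'; rewrite PE ?gE.
  have i0 : (0 : R) \in `[0, 1] by rewrite in_itv /= lexx ler01.
  have i1 : (1 : R) \in `[0, 1] by rewrite in_itv /= lexx ler01.
  have Plen : length P 0 1 = dist (P 0) (P 1).
    rewrite !Pg // gamma0 -gamma_min lenE.
    rewrite (orbit_length EY (p := p) ler01) ?subr0 ?mul1r ?YX // => t t'.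
    by apply: PE; exact: subset_itv_oo_cc t'.
  split; last by case: (dist_minimal_orbit EY PE Plen t01).
  apply: sphere_curve_orbit EY _ _.
    by move: t01; rewrite in_itv /= => /andP[].
  move=> t; rewrite in_itv /= => /andP[tt t1]; apply: PE.
  rewrite in_itv /= t1 (le_trans _ tt) //.
  by move: t01; rewrite in_itv /= => /andP[].
Unshelve. all: by end_near. Qed.
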